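(* Let $c_0>0$, $0<\alpha_1<1$, $\gamma\in(0,2)$, and for $\vec k\in\mathbb{R}^3$ let $A(\vec k)=-\alpha_1c_0|\vec k|^\gamma$ and $B(\vec k)=c_0\sqrt{|\vec k|^2-\alpha_1^2|\vec k|^{2\gamma}}$. Define $$\mathcal{G}(\vec x,t)=\frac{H(t)c_0^2}{(2\pi)^{3/2}}\,\mathcal{F}_{3D}\left\{e^{A(\cdot)t}\frac{\sin(B(\cdot)t)}{B(\cdot)}\right\}(\vec x).$$ Then there does not exist a constant $c>0$ such that $\mathrm{supp}(\mathcal{G}(\cdot,t))\subseteq B_{ct}(\mathbf 0)$ for all $t>0$; i.e. for each $c>0$ the function $t\mapsto\mathcal{G}(\vec x,t+|\vec x|/c)$ is not causal.
   Context: $\mathcal{F}_{3D}\{f\}(\vec x)=\frac{1}{(2\pi)^{3/2}}\int_{\mathbb{R}^3}e^{i\vec x\cdot\vec k}f(\vec k)\,d\vec k$; $H$ is the Heaviside function; $B_R(\mathbf 0)$ is the open ball of radius $R$ centered at the origin; the square root is the complex root with non-negative real part. A function of $t$ is causal if it vanishes for $t<0$. *)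

(* Defs.v *)
From HB Require Import structures.
From mathcomp Require Import all_boot all_order all_algebra.
From mathcomp Require Import all_classical all_reals all_analysis.
From mathcomp Require Import complex.
Set Implicit Arguments. Unset Strict Implicit. Unset Printing Implicit Defensive.
Import Order.TTheory GRing.Theory Num.Theory.
Import numFieldNormedType.Exports.
Local Open Scope classical_set_scope.
Local Open Scope ring_scope.

(* R^3, as triples ((x1, x2), x3) of reals.  [R3 R] carries the topology
   (product topology = Euclidean topology), [R3m R] is the same carrier
   seen as a measurable space (product of Borel/Lebesgue sigma-algebras). *)
Definition R3 (R : realType) := ((R * R) * R)%type.
Definition R3m (R : realType) :=
  ((measurableTypeR R * measurableTypeR R) * measurableTypeR R)%type.

Definition dot3 {R : realType} (x k : R3 R) : R :=
  x.1.1 * k.1.1 + x.1.2 * k.1.2 + x.2 * k.2.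
Definition norm3 {R : realType} (x : R3 R) : R := Num.sqrt (dot3 x x).

Definition leb3 (R : realType) :=
  ((@lebesgue_measure R \x @lebesgue_measure R) \x @lebesgue_measure R)%E.

(* F_3D{f}(x) = (2 pi)^(-3/2) \int_{R^3} e^{i x.k} f(k) dk, for a REAL-valued
   f, written out through real and imaginary parts:
   Re = (2pi)^(-3/2) \int cos(x.k) f(k) dk, Im = (2pi)^(-3/2) \int sin(x.k) f(k) dk. *)
Definition F3D {R : realType} (f : R3 R -> R) (x : R3 R) : R[i] :=
  let s := (2 * pi) `^ (3%:R / 2) in
  ((Rintegral (@leb3 R) setT (fun k : R3m R => cos (dot3 x k) * f k) / s)
   +i* (Rintegral (@leb3 R) setT (fun k : R3m R => sin (dot3 x k) * f k) / s))%C.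

(* Heaviside function (the value at 0 plays no role below) *)
Definition Heaviside {R : realType} (t : R) : R := if 0 <= t then 1 else 0.

Definition Afun {R : realType} (c0 alpha1 gamma : R) (k : R3 R) : R :=
  - (alpha1 * c0 * (norm3 k `^ gamma)).

(* sin(B(k) t) / B(k) with B(k) = c0 sqrt(|k|^2 - alpha1^2 |k|^(2 gamma)), the
   square root being the complex one with nonnegative real part.  Writing
   D = |k|^2 - alpha1^2 |k|^(2 gamma):
   - D > 0 : B = c0 sqrt D real,        sin(Bt)/B = sin(c0 sqrt D t)/(c0 sqrt D);
   - D < 0 : B = i c0 sqrt(-D),         sin(Bt)/B = sinh(c0 sqrt(-D) t)/(c0 sqrt(-D));
   - D = 0 : B = 0, value by continuity sin(Bt)/B = t. *)
Definition sinBt_over_B {R : realType} (c0 alpha1 gamma : R) (k : R3 R) (t : R) : R :=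
  let D := norm3 k ^+ 2 - alpha1 ^+ 2 * (norm3 k `^ (2 * gamma)) in
  if 0 < D then
    let b := c0 * Num.sqrt D in sin (b * t) / b
  else if D < 0 then
    let b := c0 * Num.sqrt (- D) in ((expR (b * t) - expR (- (b * t))) / 2) / b
  else t.

Definition Gfun {R : realType} (c0 alpha1 gamma : R) (x : R3 R) (t : R) : R[i] :=
  ((Heaviside t * c0 ^+ 2 / (2 * pi) `^ (3%:R / 2))%:C *
   F3D (fun k => expR (Afun c0 alpha1 gamma k * t) * sinBt_over_B c0 alpha1 gamma k t) x)%C.

Definition support3 {R : realType} {V : zmodType} (g : R3 R -> V) : set (R3 R) :=
  closure [set x : R3 R | g x != 0].

Definition ball3 {R : realType} (r : R) : set (R3 R) := [set x | norm3 x < r].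

(* Main.v *)
Require Import Defs.
From HB Require Import structures.
From mathcomp Require Import all_boot all_order all_algebra.
From mathcomp Require Import all_classical all_reals all_analysis.
From mathcomp Require Import measurable_realfun complex.
From mathcomp Require Import lra ring.
Import Order.TTheory GRing.Theory Num.Theory.
Import numFieldNormedType.Exports.
Local Open Scope classical_set_scope.
Local Open Scope ring_scope.

(* Already at t = 1, compact support of G(., 1) would force the symbol
   f = exp(A) sin(B)/B to be twice differentiable at the origin, whereas
   f(k) <= 1 - x/2 with x = alpha1 c0 |k|^gamma <= 1, and gamma < 2.
   No Fourier inversion is needed.  If the transform of f vanishes for
   |x| >= rho, then the second difference
     D(k) = f(k + eta e3) + f(k - eta e3) - 2 f(k)
   has cosine transform 2 (cos(x3 eta) - 1) times that of f, which is bounded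
   by rho^2 eta^2 |f|_1 and vanishes outside a cube.  Integrating D against the
   product of the kernels 1/(1 + (N k_i)^2), each of which is the cosine
   transform of an exponential, gives O(N^-3 eta^2).  Rescaling and letting
   N tend to infinity (dominated convergence; f is continuous at 0 and
   f(0) = 1) yields eta^gamma = O(eta^2) as eta -> 0, a contradiction. *)

(** * The Poisson kernel as a cosine transform *)

Lemma measurable_cos (R : realType) : measurable_fun setT (cos : R -> R).
Proof. by apply: continuous_measurable_fun; exact: continuous_cos. Qed.

(** Extended by zero to the whole line, so that every integral ranges over [setT] and Fubini applies
    directly. *)
Definition expw {R : realType} (x : R) : R := if 0 <= x then expR (- x) else 0.

Lemma expw_ge0 (R : realType) (x : R) : 0 <= expw x.
Proof. by rewrite /expw; case: ifP => // _; exact: expR_ge0. Qed.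

Lemma measurable_expw (R : realType) : measurable_fun setT (@expw R).
Proof.
apply: measurable_fun_ifT.
- by apply: measurable_fun_ler; [exact: measurable_cst|exact: measurable_id].
- apply: measurableT_comp; first exact: measurable_expR.
  exact: oppr_measurable.
- exact: measurable_cst.
Qed.

(* The summand 1 makes the integrand nonnegative, as the improper form of the
   fundamental theorem of calculus requires. *)
Lemma integral_expw_cosD1 (R : realType) (y : R) :
  (\int[@lebesgue_measure R]_x (expw x * (1 + cos (x * y)))%:E
   = (1 + (1 + y ^+ 2)^-1)%:E)%E.
Proof.
have y1 : 1 + y ^+ 2 != 0 by apply: lt0r_neq0; have := sqr_ge0 y; lra.
pose f (x : R) := expR (- x) * (1 + cos (x * y)).
(* The antiderivative of exp(-x) cos(xy) is exp(-x) (y sin(xy) - cos(xy)) / (1 + y^2); the term -1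
   accounts for the summand 1. *)
pose F (x : R) :=
  expR (- x) * (-1 + (y * sin (x * y) - cos (x * y)) / (1 + y ^+ 2)).
have dF (x : R) : is_derive x 1 F (f x).
  rewrite /F /f; apply: is_derive_eq.
  by rewrite /GRing.scale/=; field.
have cvF : continuous F.
  by move=> x; apply/differentiable_continuous/derivable1_diffP; case: (dF x).
have cf : continuous f.
  move=> x; apply: cvgM.
    by apply: continuous_comp; [exact: cvgN|exact: continuous_expR].
  apply: cvgD; first exact: cvg_cst.
  apply: continuous_comp; last exact: continuous_cos.
  by apply: cvgM; [exact: cvg_id|exact: cvg_cst].
have F0 : F 0 = - (1 + (1 + y ^+ 2)^-1).
  by rewrite /F oppr0 expR0 !mul0r sin0 cos0; field.
transitivity (\int[@lebesgue_measure R]_(x in `[0%R, +oo[) (f x)%:E)%E.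
  rewrite [RHS]integral_mkcond; apply: eq_integral => x _.
  rewrite patchE /expw /f mem_setE in_itv/= andbT.
  by case: ifP => //; rewrite mul0r.
have -> : (1 + (1 + y ^+ 2)^-1)%:E = (0%:E - (F 0)%:E)%E.
  by rewrite F0 -EFinB sub0r opprK.
apply: ge0_continuous_FTC2y.
- by move=> x _; rewrite /f mulr_ge0 ?expR_ge0// -lerBlDl sub0r cos_geN1.
- exact: continuous_subspaceT.
- have bnd x : `|-1 + (y * sin (x * y) - cos (x * y)) / (1 + y ^+ 2)|
      <= 1 + (`|y| + 1) / (1 + y ^+ 2).
    rewrite (le_trans (ler_normD _ _))// normrN1 lerD2l normrM.
    rewrite [X in _ * X <= _]ger0_norm; last first.
      by rewrite invr_ge0; have := sqr_ge0 y; lra.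
    apply: ler_wpM2r; first by rewrite invr_ge0; have := sqr_ge0 y; lra.
    rewrite (le_trans (ler_normB _ _))// lerD ?cos_max// normrM.
    by rewrite ler_piMr// sin_max.
  have lim0 : expR (- x) * (1 + (`|y| + 1) / (1 + y ^+ 2)) @[x --> +oo] --> 0.
    by rewrite -[X in _ --> X](mul0r (1 + (`|y| + 1) / (1 + y ^+ 2)));
      apply: cvgM; [exact: cvgr_expR|exact: cvg_cst].
  apply/cvgr0Pnorm_le => e e0.
  apply: filterS (cvgr0_norm_le _ lim0 _ e0) => x; apply: le_trans.
  by rewrite /F !normrM ler_wpM2l// (le_trans (bnd x))// ler_norm.
- by move=> x _; case: (dF x).
- exact/cvg_at_right_filter/cvF.
- by move=> x _; rewrite derive1E; have [_] := dF x.
Qed.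

(** The case y = 0 of the previous formula, where 1 + cos is the constant 2. *)
Lemma integral_expw (R : realType) :
  (\int[@lebesgue_measure R]_x (expw x)%:E = 1)%E.
Proof.
have := integral_expw_cosD1 R 0; rewrite expr0n/= addr0 invr1.
under eq_integral do rewrite mulr0 cos0 mulrC EFinM.
rewrite ge0_integralZl_EFin//; last 2 first.
- by move=> x _; rewrite lee_fin expw_ge0.
- by apply/measurable_EFinP; exact: measurable_expw.
have two : (1 + 1 : R) != 0 by rewrite -mulr2n pnatr_eq0.
move=> /(congr1 (fun z => ((1 + 1)^-1)%:E * z)%E).
by rewrite muleA -!EFinM mulVf// mul1e.
Qed.

Lemma integrable_expw (R : realType) :
  (@lebesgue_measure R).-integrable setT (EFin \o expw).
Proof.
apply/integrableP; split; first by apply/measurable_EFinP; exact: measurable_expw.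
under eq_integral do rewrite /= ger0_norm ?expw_ge0//.
by rewrite integral_expw ltry.
Qed.

Lemma integral_expw_cos (R : realType) (y : R) :
  (\int[@lebesgue_measure R]_x (expw x * cos (x * y))%:E
   = ((1 + y ^+ 2)^-1)%:E)%E.
Proof.
have mc : measurable_fun setT (fun x : measurableTypeR R => cos (x * y)).
  apply: (measurableT_comp (measurable_cos R)).
  exact: mulrr_measurable.
have ic : (@lebesgue_measure R).-integrable setT
    (fun x => (expw x * cos (x * y))%:E).
  apply: le_integrable (integrable_expw R) => //.
    by apply/measurable_EFinP; apply: measurable_funM; first exact: measurable_expw.
  by move=> x _/=; rewrite lee_fin normrM ler_piMr// cos_max.
have := integral_expw_cosD1 R y.
under eq_integral do rewrite mulrDr mulr1 EFinD.
rewrite integralD//; last exact: integrable_expw.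
rewrite integral_expw EFinD => /(congr1 (fun z => z - 1%:E)%E).
by rewrite [in LHS]addeAC [in RHS]addeAC subee// !add0e.
Qed.

(** Write 1/(1 + phi^2) as the cosine transform of [expw] at phi and exchange the two integrals.
    Measurability of [a] is recorded because the result is estimated under the integral sign
    afterwards. *)
Lemma Fubini_poisson d (X : measurableType d) (R : realType)
    (mu : {sigma_finite_measure set X -> \bar R}) (g phi : X -> R) :
  mu.-integrable setT (EFin \o g) -> measurable_fun setT phi ->
  let a (x : measurableTypeR R) : R :=
    expw x * \int[mu]_p (g p * cos (x * phi p)) in
  measurable_fun setT a /\
  (\int[mu]_p (g p / (1 + phi p ^+ 2))%:E =
   \int[@lebesgue_measure R]_x (a x)%:E)%E.
Proof.
move=> ig mphi a.
have mg : measurable_fun setT g by apply/measurable_EFinP; case/integrableP: ig.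
have mcos x : measurable_fun setT (fun p : X => cos (x * phi p)).
  apply: (measurableT_comp (measurable_cos R)).
  by apply: measurable_funM => //; exact: measurable_cst.
pose h (z : X * measurableTypeR R) : R :=
  g z.1 * (expw z.2 * cos (z.2 * phi z.1)).
have mh0 : measurable_fun setT h.
  apply: measurable_funM.
    exact: measurableT_comp measurable_fst.
  apply: measurable_funM.
    exact: (measurableT_comp (@measurable_expw R) measurable_snd).
  apply: (measurableT_comp (measurable_cos R)).
  apply: measurable_funM; first exact: measurable_snd.
  exact: measurableT_comp measurable_fst.
have mh : measurable_fun setT (EFin \o h) by exact/measurable_EFinP.
(* Since |cos| is at most 1 and [expw] has integral 1, the inner integral of |h| is at most |g
   p|. *)
have ih : (mu \x @lebesgue_measure R)%E.-integrable setT (EFin \o h).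
  apply/(integrable12ltyP _ _ mh).
  apply: (@le_lt_trans _ _ (\int[mu]_p `|(g p)%:E|)%E); last first.
    by case/integrableP: ig.
  apply: ge0_le_integral => //.
  - by move=> p _; apply: integral_ge0.
  - apply: (measurable_fun_fubini_tonelli_F (abse \o (EFin \o h))) => [|z].
      exact: measurableT_comp.
    exact: abse_ge0.
  - by apply: (measurableT_comp (f := abse)) => //; exact/measurable_EFinP.
  - move=> p _; rewrite -[leRHS]mule1 -(@integral_expw R).
    rewrite -ge0_integralZl//; last 2 first.
      by apply/measurable_EFinP; exact: measurable_expw.
      by move=> x _; rewrite lee_fin expw_ge0.
    apply: ge0_le_integral => //.
    + apply: (measurableT_comp (f := abse)) => //; apply/measurable_EFinP.
      exact: (measurableT_comp mh0 (pair1_measurable p)).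
    + apply/measurable_EFinP; apply: measurable_funM => //.
      exact: measurable_expw.
    + move=> x _; rewrite /h/= -EFinM lee_fin !normrM ler_wpM2l//.
      by rewrite ger0_norm ?expw_ge0// ler_piMr ?expw_ge0// cos_max.
have aE : EFin \o a = fubini_G mu (EFin \o h).
  apply/funext => x; rewrite /fubini_G.
  have igc : mu.-integrable setT (fun p => (g p * cos (x * phi p))%:E).
    apply: le_integrable ig => //.
      by apply/measurable_EFinP; exact: measurable_funM.
    by move=> p _/=; rewrite lee_fin normrM ler_piMr// cos_max.
  rewrite /a/= EFinM fineK ?integrable_fin_num// -integralZl//.
  by apply: eq_integral => p _; rewrite /h/= -EFinM mulrCA.
split; first by apply/measurable_EFinP; rewrite aE; exact: (measurable_fubini_G ih).
transitivity (\int[mu]_p \int[@lebesgue_measure R]_x (EFin \o h) (p, x))%E.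
  apply: eq_integral => p _; rewrite EFinM -integral_expw_cos -integralZl//.
  apply: le_integrable (integrable_expw R) => //.
    apply/measurable_EFinP; apply: measurable_funM.
      exact: measurable_expw.
    apply: (measurableT_comp (measurable_cos R)).
    exact: mulrr_measurable.
  by move=> x _/=; rewrite lee_fin normrM ler_piMr// cos_max.
rewrite Fubini//; apply: eq_integral => x _.
by have /(congr1 (fun u => u x))/= -> := aE.
Qed.

(** The weight [expw] is at most 1 and lives on x >= 0, so the outer integral is that of a function
    bounded by M on [0, r] and zero elsewhere. *)
Lemma poisson_bound d (X : measurableType d) (R : realType)
    (mu : {sigma_finite_measure set X -> \bar R}) (g phi : X -> R) (r M : R) :
  mu.-integrable setT (EFin \o g) -> measurable_fun setT phi -> 0 <= r -> 0 <= M ->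
  (forall x, 0 <= x ->
    `|\int[mu]_p (g p * cos (x * phi p))| <= if x <= r then M else 0) ->
  `|\int[mu]_p (g p / (1 + phi p ^+ 2))| <= r * M.
Proof.
move=> ig mphi r0 M0 gM.
have [ma E] := Fubini_poisson _ _ _ _ _ _ ig mphi.
pose I := `[0, r]%classic : set (measurableTypeR R).
have mI : measurable I by exact: measurable_itv.
have le1 : (`|\int[mu]_p (g p / (1 + phi p ^+ 2))%:E| <= (r * M)%:E)%E.
  rewrite E; apply: le_trans (le_abse_integral _ _ _) _ => //.
    exact/measurable_EFinP.
  apply: (@le_trans _ _
    (\int[@lebesgue_measure R]_x (M%:E * (\1_I x)%:E))%E); last first.
    rewrite ge0_integralZl_EFin//; last first.
      by apply/measurable_EFinP; exact: measurable_indic.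
    rewrite integral_indic// setIT /I/= lebesgue_measure_itv/= lte_fin.
    case: ltP => [_|_]; first by rewrite -EFinD -EFinM subr0 mulrC.
    by rewrite mule0 lee_fin mulr_ge0.
  apply: ge0_le_integral => //.
  - by apply: (measurableT_comp (f := abse)) => //; exact/measurable_EFinP.
  - apply/measurable_EFinP; apply: measurable_funM; first exact: measurable_cst.
    exact: measurable_indic.
  - move=> x _; rewrite -EFinM lee_fin normrM indicE mem_setE in_itv/=.
    rewrite ger0_norm ?expw_ge0// /expw; case: ifPn => x0/=; last first.
      by rewrite mul0r mulr0.
    have := gM x x0; case: ifP => xr h; last first.
      by rewrite mulr0 (le_trans (ler_wpM2l _ h)) ?expR_ge0// mulr0.
    rewrite mulr1 (le_trans (ler_wpM2l _ h)) ?expR_ge0//.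
    by rewrite ler_piMl// -expR0 ler_expR oppr_le0.
by rewrite /Rintegral; case: (\int[mu]_p _)%E le1.
Qed.

(** * Affine changes of variables in R^3 *)

(** Here s is the Jacobian of T. The condition is put on sets so that it can be verified on
    generators (intervals, then rectangles) by uniqueness of measures. *)
Definition scales_measure d (X : measurableType d) (R : realType)
    (mu : set X -> \bar R) (s : R) (T : X -> X) :=
  measurable_fun setT T /\
  forall A, measurable A -> (mu A = s%:E * mu (T @^-1` A))%E.

(** Packages the right-hand side of [scales_measure] as a measure, the form that the uniqueness
    theorems and the pushforward formula take. *)
Definition scaled_image d (X : measurableType d) (R : realType)
    (mu : {measure set X -> \bar R}) (s : R) (s0 : 0 < s) (T : X -> X)
    (mT : measurable_fun setT T) : {measure set X -> \bar R} :=
  mscale (NngNum (ltW s0))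
    (measure_function_pushforward__canonical__measure_function_Measure mu mT).

Lemma scales_measure_ge0_integral d (X : measurableType d) (R : realType)
    (mu : {measure set X -> \bar R}) (s : R) (T : X -> X) (g : X -> \bar R) :
  0 < s -> scales_measure _ _ _ mu s T ->
  measurable_fun setT g -> (forall x, 0 <= g x)%E ->
  (\int[mu]_x g x = s%:E * \int[mu]_x g (T x))%E.
Proof.
move=> s0 [mT muT] mg g0.
transitivity (\int[scaled_image _ _ _ mu _ s0 _ mT]_x g x)%E.
  by apply: eq_measure_integral => A mA _; rewrite muT.
rewrite /scaled_image ge0_integral_mscale//; congr (_ * _)%E.
by rewrite ge0_integral_pushforward.
Qed.

Lemma scales_measure_integrable d (X : measurableType d) (R : realType)
    (mu : {measure set X -> \bar R}) (s : R) (T : X -> X) (g : X -> \bar R) :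
  0 < s -> scales_measure _ _ _ mu s T ->
  mu.-integrable setT g -> mu.-integrable setT (fun x => g (T x)).
Proof.
move=> s0 sT /integrableP[mg gfin]; have [mT _] := sT.
apply/integrableP; split; first exact: measurableT_comp mT.
rewrite (scales_measure_ge0_integral _ _ _ _ _ _ _ s0 sT) in gfin => //.
- rewrite ltey; apply/eqP => E; move: gfin; rewrite E.
  by rewrite gt0_muley// lte_fin.
- exact: measurableT_comp.
Qed.

Lemma scales_measure_Rintegral d (X : measurableType d) (R : realType)
    (mu : {measure set X -> \bar R}) (s : R) (T : X -> X) (g : X -> R) :
  0 < s -> scales_measure _ _ _ mu s T ->
  mu.-integrable setT (EFin \o g) ->
  \int[mu]_x g x = s * \int[mu]_x g (T x).
Proof.
move=> s0 sT ig; have mg := measurable_int _ ig.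
have igT := scales_measure_integrable _ _ _ _ _ _ _ s0 sT ig.
apply: EFin_inj; rewrite EFinM !fineK; last 2 first.
- exact: integrable_fin_num igT.
- exact: integrable_fin_num ig.
rewrite integralE [in RHS]integralE.
rewrite (scales_measure_ge0_integral _ _ _ _ _ _ ((EFin \o g)^\+)%E s0 sT)//; last first.
  exact: measurable_funepos.
rewrite (scales_measure_ge0_integral _ _ _ _ _ _ ((EFin \o g)^\-)%E s0 sT)//; last first.
  exact: measurable_funeneg.
rewrite [RHS]muleBr//; last exact: (integrable_add_def measurableT igT).
by congr (_ * _ - _ * _)%E; apply: eq_integral => x _; rewrite ?funeposE ?funenegE.
Qed.

(** The preimage of a rectangle is a rectangle, so the product measure and the scaled image agree on
    rectangles, hence everywhere. *)
Lemma scales_measure_prod d1 d2 (X1 : measurableType d1) (X2 : measurableType d2)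
    (R : realType) (m1 : {sigma_finite_measure set X1 -> \bar R})
    (m2 : {sigma_finite_measure set X2 -> \bar R}) (s t : R) S T :
  0 < s -> 0 < t ->
  scales_measure _ _ _ m1 s S -> scales_measure _ _ _ m2 t T ->
  scales_measure _ _ _ (m1 \x m2)%E (s * t) (fun z => (S z.1, T z.2)).
Proof.
move=> s0 t0 [mS m1S] [mT m2T].
have mST : measurable_fun setT (fun z : X1 * X2 => (S z.1, T z.2)).
  apply/measurable_fun_pairP; split.
    exact: (measurableT_comp mS measurable_fst).
  exact: (measurableT_comp mT measurable_snd).
split => //.
have st0 : 0 < s * t by exact: mulr_gt0.
move=> C mC.
have := @product_measure_unique _ _ _ _ _ m1 m2
  (scaled_image _ _ _ (m1 \x m2)%E _ st0 _ mST).
apply => // A B mA mB.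
have mSA : measurable (S @^-1` A) by rewrite -[X in measurable X]setTI; exact: mS.
have mTB : measurable (T @^-1` B) by rewrite -[X in measurable X]setTI; exact: mT.
rewrite -[LHS]/((s * t)%:E *
  (m1 \x m2) ((fun z => (S z.1, T z.2)) @^-1` (A `*` B)))%E.
rewrite (_ : _ @^-1` _ = (S @^-1` A) `*` (T @^-1` B))//.
by rewrite product_measure1E// (m1S A)// (m2T B)// EFinM muleACA.
Qed.

Lemma scales_lebesgue (R : realType) (a b : R) : 0 < a ->
  scales_measure _ _ _ (@lebesgue_measure R) a (fun x => a * x + b).
Proof.
move=> a0.
have mT : measurable_fun setT
    ((fun x => a * x + b) : measurableTypeR R -> measurableTypeR R).
  apply: measurable_funD; last exact: measurable_cst.
  exact: mulrl_measurable.
split => //.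
apply: (@lebesgue_measure_unique _ (scaled_image _ _ _ lebesgue_measure _ a0 _ mT)).
move=> _ [[u v]] _ <-/=.
rewrite -[RHS]/(a%:E * lebesgue_measure
  ((fun x : measurableTypeR R => (a * x + b)%R) @^-1` `]u, v]))%E.
rewrite (_ : _ @^-1` _ = `](u - b) / a, (v - b) / a]%classic); last first.
  apply/seteqP; split => x /=; rewrite !in_itv/=;
    by rewrite ltr_pdivrMr// ler_pdivlMr// ltrBlDr lerBrDr mulrC.
rewrite !lebesgue_measure_itv/= !lte_fin ltr_pM2r ?invr_gt0// ltrD2r.
case: ifPn => _; last by rewrite mule0.
by rewrite -!EFinD -EFinM; congr EFin; field; rewrite gt_eqF.
Qed.


Lemma sigma_finite_product d1 d2 (X1 : measurableType d1) (X2 : measurableType d2)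
    (R : realType) (m1 : {sigma_finite_measure set X1 -> \bar R})
    (m2 : {sigma_finite_measure set X2 -> \bar R}) :
  sigma_finite setT (m1 \x m2)%E.
Proof.
have [F FT Ffin] := sigma_finiteT m1.
have [G GT Gfin] := sigma_finiteT m2.
(* Rectangles F i x G j enumerated through [pickle]; integers that encode no pair get the empty
   set. *)
exists (fun n => if unpickle n is Some ij then F ij.1 `*` G ij.2 else set0).
  apply/esym; rewrite -subTset => -[x y] _.
  have : setT x by []. rewrite FT => -[i _ Fx].
  have : setT y by []. rewrite GT => -[j _ Gy].
  by exists (pickle (i, j)) => //; rewrite pickleK.
move=> n; case: unpickle => [[i j]|]; last by rewrite measure0 ltry.
have [mF Foo] := Ffin i; have [mG Goo] := Gfin j.
split; first exact: measurableX.
by rewrite product_measure1E// lte_mul_pinfty// ge0_fin_numE.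
Qed.

Definition product_sigma_finite d1 d2 (X1 : measurableType d1)
    (X2 : measurableType d2) (R : realType)
    (m1 : {sigma_finite_measure set X1 -> \bar R})
    (m2 : {sigma_finite_measure set X2 -> \bar R}) :
    {sigma_finite_measure set (X1 * X2)%type -> \bar R} :=
  HB.pack (m1 \x m2)%E (Measure_isSigmaFinite.Build _ _ _ (m1 \x m2)%E
    (sigma_finite_product _ _ _ _ _ m1 m2)).

(* [mu3] is convertible to [leb3]; the library has no canonical sigma-finite
   structure on the product of two sigma-finite measures. *)
Definition mu2 (R : realType) :=
  product_sigma_finite _ _ _ _ _ (@lebesgue_measure R) (@lebesgue_measure R).

Definition mu3 (R : realType) : {sigma_finite_measure set (R3m R) -> \bar R} :=
  product_sigma_finite _ _ _ _ _ (mu2 R) (@lebesgue_measure R).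

Lemma F3DE (R : realType) (f : R3 R -> R) x : F3D f x =
  let s := (2 * pi) `^ (3%:R / 2) in
  ((Rintegral (mu3 R) setT (fun k : R3m R => cos (dot3 x k) * f k) / s)
   +i* (Rintegral (mu3 R) setT (fun k : R3m R => sin (dot3 x k) * f k) / s))%C.
Proof. by []. Qed.

Definition affine3 {R : realType} (a : R) (b k : R3m R) : R3m R :=
  ((a * k.1.1 + b.1.1, a * k.1.2 + b.1.2), a * k.2 + b.2).

Lemma scales_mu3 (R : realType) (a : R) (b : R3m R) : 0 < a ->
  scales_measure _ _ _ (mu3 R) (a * a * a) (affine3 a b).
Proof.
move=> a0.
have h2 := scales_measure_prod _ _ _ _ _ (@lebesgue_measure R)
  (@lebesgue_measure R) _ _ _ _ a0 a0
  (scales_lebesgue _ _ b.1.1 a0) (scales_lebesgue _ _ b.1.2 a0).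
exact: (scales_measure_prod _ _ _ _ _ (mu2 R) (@lebesgue_measure R) _ _ _ _
  (mulr_gt0 a0 a0) a0 h2 (scales_lebesgue _ _ b.2 a0)).
Qed.

(** * Pointwise bounds on the symbol *)

Lemma sin_mean_value (R : realType) (z : R) : 0 < z ->
  exists2 c, c \in `]0, z[ & sin z = cos c * z.
Proof.
move=> z0.
have [c cz] : exists2 c, c \in `]0, z[ & sin z - sin 0 = cos c * (z - 0).
  apply: MVT => //; apply: continuous_subspaceT; exact: continuous_sin.
by rewrite sin0 !subr0; exists c.
Qed.

Lemma norm_sin_le (R : realType) (z : R) : 0 < z -> `|sin z| <= z.
Proof.
move=> z0; have [c _ ->] := sin_mean_value _ _ z0.
by rewrite normrM (gtr0_norm z0) ler_piMl ?(ltW z0)// cos_max.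
Qed.

Lemma cos_ge_quadratic (R : realType) (z : R) : 1 - z ^+ 2 / 2 <= cos z.
Proof.
wlog z0 : z / 0 < z.
  move=> h; have [z0|z0|->] := ltgtP z 0; last 1 first.
  - by rewrite cos0 expr0n/= mul0r subr0.
  - by rewrite -cosN -sqrrN; apply: h; rewrite oppr_gt0.
  - exact: h.
(* Half-angle formula: 1 - cos z = 2 sin(z/2)^2, which is at most z^2/2. *)
have z2 : 0 < z / 2 by rewrite divr_gt0.
have -> : cos z = 1 - 2 * sin (z / 2) ^+ 2.
  rewrite {1}(_ : z = (z / 2) *+ 2); last by rewrite -mulr_natr divfK.
  by rewrite cos_mulr2n cos2sin2; ring.
have : sin (z / 2) ^+ 2 <= (z / 2) ^+ 2.
  rewrite -[leLHS]real_normK ?num_real// ler_sqr ?nnegrE ?(ltW z2)//.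
  exact: norm_sin_le.
by rewrite expr_div_n; lra.
Qed.

(** By the mean value theorem sin z / z = cos c with 0 < c < z, and the quadratic bound at c is
    better than the one at z. *)
Lemma sinc_ge (R : realType) (z : R) : 0 < z -> 1 - z ^+ 2 / 2 <= sin z / z.
Proof.
move=> z0.
have [c cz ->] := sin_mean_value _ _ z0; rewrite mulfK ?gt_eqF//.
move: cz; rewrite in_itv/= => /andP[c0 cz].
rewrite (le_trans _ (cos_ge_quadratic _ c))// lerD2l lerN2 ler_pM2r//.
by rewrite ler_sqr ?nnegrE ?(ltW c0) ?(ltW z0) ?(ltW cz).
Qed.

Lemma norm_sinc_le1 (R : realType) (z : R) : 0 < z -> `|sin z / z| <= 1.
Proof.
move=> z0; rewrite normrM normfV (gtr0_norm z0) ler_pdivrMr// mul1r.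
exact: norm_sin_le.
Qed.

(** This is sinh(y)/y, in the shape that [sinBt_over_B] takes at t = 1. *)
Definition sinhc {R : realType} (y : R) : R := ((expR y - expR (- y)) / 2) / y.

(** Factoring out exp(y) lets it be merged with the damping factor exp(-x) of the symbol. *)
Lemma sinhcE (R : realType) (y : R) :
  sinhc y = expR y * ((1 - expR (- (2 * y))) / (2 * y)).
Proof.
rewrite /sinhc mulrA mulrBr mulr1 -expRD -mulrA -invfM.
by congr (_ * _); congr (_ - expR _); ring.
Qed.

Lemma sinhc_le_expR (R : realType) (y : R) : 0 < y -> sinhc y <= expR y.
Proof.
move=> y0; rewrite sinhcE ler_piMr ?expR_ge0// ler_pdivrMr ?mulr_gt0// mul1r.
by have := expR_ge1Dx (- (2 * y)); lra.
Qed.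

(** Squaring exp(-y) >= 1 - y >= 0 gives 1 - exp(-2y) <= 2y - y^2; divide by 2y. *)
Lemma sinhc_le (R : realType) (y : R) : 0 < y <= 1 ->
  sinhc y <= expR y * (1 - y / 2).
Proof.
move=> /andP[y0 y1]; rewrite sinhcE ler_wpM2l ?expR_ge0// ler_pdivrMr ?mulr_gt0//.
have : (1 - y) ^+ 2 <= expR (- (2 * y)).
  have -> : expR (- (2 * y)) = expR (- y) ^+ 2 by rewrite -expRM_natl; congr expR; ring.
  rewrite ler_sqr ?nnegrE ?expR_ge0// ?subr_ge0//.
  exact: expR_ge1Dx.
by nra.
Qed.

Lemma sinhc_ge1 (R : realType) (y : R) : 0 < y -> 1 <= sinhc y.
Proof.
move=> y0; rewrite /sinhc ler_pdivlMr// mul1r ler_pdivlMr// -subr_ge0.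
(* h vanishes at 0 and its derivative exp(x) + exp(-x) - 2 = (exp(x) - 1)^2 / exp(x) is
   nonnegative. *)
pose h (x : R) := expR x - expR (- x) - x * 2.
have dh (x : R) : is_derive x 1 h (expR x + expR (- x) - 2).
  by rewrite /h; apply: is_derive_eq; rewrite /GRing.scale/=; ring.
have [c cz] : exists2 c, c \in `]0, y[ &
    h y - h 0 = (expR c + expR (- c) - 2) * (y - 0).
  apply: (@MVT R h (fun x => expR x + expR (- x) - 2)) => //.
  apply: continuous_subspaceT => x.
  by apply/differentiable_continuous/derivable1_diffP; case: (dh x).
rewrite /h oppr0 expR0 subrr mul0r !subr0 => ->.
apply: mulr_ge0; last by rewrite addr0 ltW.
rewrite expRN.
have -> : expR c + (expR c)^-1 - 2 = (expR c - 1) ^+ 2 / expR c.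
  by field; rewrite gt_eqF// expR_gt0.
by rewrite divr_ge0 ?sqr_ge0 ?expR_ge0.
Qed.

(* The exponent 3 is the dimension: (1 + |k|^2)^3 dominates the product of the
   1 + k_i^2, whose inverse is integrable. *)
Lemma expR_powR_decay (R : realType) (a b : R) : 0 < a -> 0 < b ->
  exists2 C : R, 0 < C & forall r, 0 <= r ->
    expR (- (a * r `^ b)) * (1 + r ^+ 2) ^+ 3 <= C.
Proof.
(* The power p is chosen so that (r^b)^p = r^6, the growth of (1 + r^2)^3. The factor 8 = 2^3 comes
   from 1 + r^2 <= 2 for r <= 1 and 1 + r^2 <= 2 r^2 for r > 1. *)
move=> a0 b0; pose p := 6 / b; have p0 : 0 < p by rewrite divr_gt0.
exists (8 + 8 * (p / a) `^ p).
  by rewrite ltr_wpDr// mulr_ge0// powR_ge0.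
move=> r r0; have [r1|r1] := leP r 1.
  rewrite (@le_trans _ _ (1 * 8))//; last first.
    by rewrite mul1r lerDl mulr_ge0// powR_ge0.
  rewrite ler_pM ?expR_ge0 ?exprn_ge0 ?addr_ge0 ?sqr_ge0//.
    by rewrite -expR0 ler_expR oppr_le0 mulr_ge0 ?powR_ge0// ltW.
  have -> : 8 = 2 ^+ 3 :> R by ring.
  by rewrite lerXn2r ?nnegrE ?addr_ge0 ?sqr_ge0//; nra.
have r6 : (1 + r ^+ 2) ^+ 3 <= 8 * r ^+ 6.
  have -> : 8 * r ^+ 6 = (2 * r ^+ 2) ^+ 3 by ring.
  by rewrite lerXn2r ?nnegrE ?addr_ge0 ?mulr_ge0 ?sqr_ge0//; nra.
(* With u = a r^b / p, raise u <= exp(u) to the power p. *)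
have key : r ^+ 6 <= (p / a) `^ p * expR (a * r `^ b).
  have -> : r ^+ 6 = (r `^ b) `^ p.
    by rewrite -powRrM /p mulrC divfK ?gt_eqF// powR_mulrn.
  have -> : expR (a * r `^ b) = (expR (a * r `^ b / p)) `^ p.
    by rewrite -expRM divfK ?gt_eqF.
  have pa : 0 < p / a by rewrite divr_gt0.
  rewrite -powRM ?expR_ge0 ?(ltW pa)//; apply: ge0_ler_powR.
  - exact: ltW.
  - by rewrite nnegrE powR_ge0.
  - by rewrite nnegrE mulr_ge0 ?expR_ge0 ?(ltW pa).
  - rewrite (le_trans _ (ler_wpM2l (ltW pa) (expR_ge1Dx _)))//.
    rewrite mulrDr mulr1 ler_wpDl ?(ltW pa)// le_eqVlt.
    by apply/orP; left; apply/eqP; field; rewrite !gt_eqF.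
rewrite (le_trans (ler_wpM2l (expR_ge0 _) r6))// mulrCA -lerBlDl.
set E := expR (- (a * r `^ b)) in key *.
rewrite (@le_trans _ _ (8 * (E * ((p / a) `^ p * expR (a * r `^ b)))))//.
  rewrite (@le_trans _ _ (8 * (E * r ^+ 6)))// ?gerBl//.
  by rewrite ler_wpM2l// ler_wpM2l// expR_ge0.
by rewrite ler_wpM2l// mulrCA -expRD addNr expR0 mulr1.
Qed.

Lemma norm3_ge0 (R : realType) (k : R3 R) : 0 <= norm3 k.
Proof. exact: sqrtr_ge0. Qed.

(* Values of sin(B)/B for x = -A and s = (c0 |k|)^2, so that B^2 = s - x^2. *)
Variant symbol_spec {R : realType} (x s : R) : R -> Prop :=
| SymbolOscillating b of 0 < b & b ^+ 2 <= s : symbol_spec x s (sin b / b)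
| SymbolDamped y of 0 < y & 0 < x & 0 < s & y ^+ 2 = x ^+ 2 - s :
    symbol_spec x s (sinhc y)
| SymbolCritical : symbol_spec x s 1.

Lemma sinBt_over_BP (R : realType) (c0 alpha1 gamma : R) (k : R3 R) :
  0 < c0 -> 0 < alpha1 -> 0 < gamma ->
  symbol_spec (alpha1 * c0 * norm3 k `^ gamma) ((c0 * norm3 k) ^+ 2)
    (sinBt_over_B c0 alpha1 gamma k 1).
Proof.
move=> c0_gt0 a_gt0 g_gt0; rewrite /sinBt_over_B.
set r := norm3 k; have r_ge0 : 0 <= r by exact: norm3_ge0.
have -> : r `^ (2 * gamma) = (r `^ gamma) ^+ 2.
  by rewrite mulrC powRrM powR_mulrn// powR_ge0.
set u := r `^ gamma; have u_ge0 : 0 <= u by exact: powR_ge0.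
rewrite !mulr1; case: ifPn => [D0|_].
  apply: SymbolOscillating; first by rewrite mulr_gt0// sqrtr_gt0.
  rewrite !exprMn sqr_sqrtr ?(ltW D0)// ler_wpM2l ?sqr_ge0//.
  by rewrite gerBl mulr_ge0 ?sqr_ge0.
case: ifPn => D0; last exact: SymbolCritical.
(* At k = 0 the discriminant is 0, so the damped case excludes the origin; this gives x > 0 and s >
   0. *)
have r_gt0 : 0 < r.
  rewrite lt_neqAle r_ge0 andbT eq_sym; apply/eqP => r0.
  by move: D0; rewrite /u r0 powR0 ?gt_eqF// expr0n/= mulr0 subr0 ltxx.
apply: SymbolDamped.
- by rewrite mulr_gt0// sqrtr_gt0 oppr_gt0.
- by rewrite !mulr_gt0// /u powR_gt0.
- by rewrite exprn_gt0// mulr_gt0.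
- by rewrite exprMn sqr_sqrtr ?oppr_ge0 ?(ltW D0)//; ring.
Qed.

(** The integrand of [Gfun] at t = 1; the redundant factor 1 keeps it literally the function
    transformed there. *)
Definition symbol {R : realType} (c0 alpha1 gamma : R) (k : R3 R) : R :=
  expR (Afun c0 alpha1 gamma k * 1) * sinBt_over_B c0 alpha1 gamma k 1.

Section symbol_bounds.
Context {R : realType} (c0 alpha1 gamma : R).
Hypotheses (c0_gt0 : 0 < c0) (alpha1_gt0 : 0 < alpha1) (gamma_gt0 : 0 < gamma).
Implicit Type k : R3 R.

Let damping k := alpha1 * c0 * norm3 k `^ gamma.

Let damping_ge0 k : 0 <= damping k.
Proof. by rewrite !mulr_ge0 ?powR_ge0// ltW. Qed.

Let symbolE k : symbol c0 alpha1 gamma k =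
  expR (- damping k) * sinBt_over_B c0 alpha1 gamma k 1.
Proof. by rewrite /symbol /Afun mulr1. Qed.

(** From s = (x - y)(x + y) and y < x one gets x - y >= s/(2x). *)
Let damped_lt (x y s : R) : 0 < y -> 0 < x -> 0 < s -> y ^+ 2 = x ^+ 2 - s ->
  y + s / (2 * x) <= x.
Proof.
move=> y0 x0 s0 E.
have yx : y < x by rewrite -ltr_sqr ?nnegrE ?ltW// E ltrBlDr ltrDl.
rewrite -lerBrDl ler_pdivrMr ?mulr_gt0//.
have -> : s = (x - y) * (x + y) by rewrite -subr_sqr E; ring.
by rewrite ler_wpM2l ?subr_ge0 ?(ltW yx)//; lra.
Qed.

(** The first exponential covers the oscillating and critical cases. In the damped case exp(y - x)
    <= exp(-s/(2x)), and s/(2x) is the second exponent, which grows at infinity precisely when gamma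
    < 2. *)
Lemma norm_symbol_decay k :
  `|symbol c0 alpha1 gamma k| <= expR (- (alpha1 * c0 * norm3 k `^ gamma)) +
    expR (- (c0 / (2 * alpha1) * norm3 k `^ (2 - gamma))).
Proof.
rewrite symbolE normrM ger0_norm ?expR_ge0//.
have := sinBt_over_BP _ c0 alpha1 gamma k c0_gt0 alpha1_gt0 gamma_gt0.
rewrite -/(damping k); set x := damping k.
case=> [b b0 _|y y0 x0 s0 E|].
- rewrite ler_wpDr ?expR_ge0// ler_piMr ?expR_ge0//.
  exact: norm_sinc_le1.
- rewrite ler_wpDl ?expR_ge0// ger0_norm; last first.
    exact: le_trans (sinhc_ge1 _ _ y0).
  rewrite (le_trans (ler_wpM2l (expR_ge0 _) (sinhc_le_expR _ _ y0)))//.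
  rewrite -expRD ler_expR.
  have := damped_lt x y _ y0 x0 s0 E.
  have -> : (c0 * norm3 k) ^+ 2 / (2 * x)
      = c0 / (2 * alpha1) * norm3 k `^ (2 - gamma).
    have r0 : norm3 k != 0.
      by apply/eqP => r0; move: s0; rewrite r0 mulr0 expr0n ltxx.
    rewrite powRB ?r0 ?implybT// powR_mulrn ?norm3_ge0// /x /damping.
    by field; rewrite !gt_eqF// powR_gt0// lt_neqAle eq_sym r0 norm3_ge0.
  by lra.
- by rewrite normr1 mulr1 ler_wpDr ?expR_ge0.
Qed.

Lemma norm_symbol_le1 k : `|symbol c0 alpha1 gamma k| <= 1.
Proof.
rewrite symbolE normrM ger0_norm ?expR_ge0//.
have := sinBt_over_BP _ c0 alpha1 gamma k c0_gt0 alpha1_gt0 gamma_gt0.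
have x_ge0 := damping_ge0 k; rewrite -/(damping k).
have ex1 : expR (- damping k) <= 1 by rewrite -expR0 ler_expR oppr_le0.
case=> [b b0 _|y y0 x0 s0 E|].
- by rewrite mulr_ile1 ?expR_ge0// norm_sinc_le1.
- rewrite ger0_norm; last exact: le_trans (sinhc_ge1 _ _ y0).
  rewrite (le_trans (ler_wpM2l (expR_ge0 _) (sinhc_le_expR _ _ y0)))//.
  rewrite -expRD -expR0 ler_expR addrC subr_le0.
  have := damped_lt _ _ _ y0 x0 s0 E; apply: le_trans.
  by rewrite lerDl ltW// divr_gt0// mulr_gt0.
- by rewrite normr1 mulr1.
Qed.

(** For x <= 1, exp(-x) <= 1/(1 + x) <= 1 - x/2, which settles the oscillating and critical cases.
    In the damped case exp(y - x) accounts for the loss in x - y and [sinhc_le] for the loss in y;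
    together they still give x/2. *)
Lemma symbol_le k : damping k <= 1 ->
  symbol c0 alpha1 gamma k <= 1 - damping k / 2.
Proof.
move=> x1; rewrite symbolE.
have := sinBt_over_BP _ c0 alpha1 gamma k c0_gt0 alpha1_gt0 gamma_gt0.
have := damping_ge0 k; rewrite -/(damping k); move: (damping k) x1 => x x1 x0.
have ex (d : R) : 0 <= d -> expR (- d) <= (1 + d)^-1.
  by move=> d0; rewrite expRN lef_pV2 ?posrE ?expR_gt0 ?expR_ge1Dx//; lra.
have ex2 : expR (- x) <= 1 - x / 2.
  rewrite (le_trans (ex _ x0))// -div1r ler_pdivrMr; last by lra.
  by nra.
case=> [b b0 _|y y0 x_gt0 s0 E|].
- rewrite (le_trans _ ex2)// ler_piMr ?expR_ge0//.
  by rewrite (le_trans (ler_norm _))// norm_sinc_le1.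
- have yx : y <= x.
    have := damped_lt _ _ _ y0 x_gt0 s0 E; apply: le_trans.
    by rewrite lerDl ltW// divr_gt0// mulr_gt0.
  have y1 : 0 < y <= 1 by rewrite y0 (le_trans yx).
  rewrite (le_trans (ler_wpM2l (expR_ge0 _) (sinhc_le _ _ y1)))//.
  rewrite mulrA -expRD (_ : - x + y = - (x - y)); last by ring.
  have d0 : 0 <= x - y by rewrite subr_ge0.
  have y2 : 0 <= 1 - y / 2 by move: y1 => /andP[_]; lra.
  rewrite (le_trans (ler_wpM2r y2 (ex _ d0)))//.
  by rewrite mulrC ler_pdivrMr; [nra|lra].
- by rewrite mulr1.
Qed.

(** Serves continuity at the origin: sin(b)/b loses at most b^2/2 <= s/2, and [sinhc] is at least
    1. *)
Lemma symbol_ge k :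
  expR (- damping k) * (1 - (c0 * norm3 k) ^+ 2 / 2) <= symbol c0 alpha1 gamma k.
Proof.
rewrite symbolE ler_wpM2l ?expR_ge0//.
have sq0 := sqr_ge0 (c0 * norm3 k).
have := sinBt_over_BP _ c0 alpha1 gamma k c0_gt0 alpha1_gt0 gamma_gt0.
case=> [b b0 bs|y y0 x0 s0 E|].
- by rewrite (le_trans _ (sinc_ge _ _ b0))//; lra.
- by rewrite (le_trans _ (sinhc_ge1 _ _ y0))//; lra.
- by lra.
Qed.

End symbol_bounds.

(** * Integrability of the symbol *)

Lemma ge0_integral_product d1 d2 (X1 : measurableType d1) (X2 : measurableType d2)
    (R : realType) (m1 : {sigma_finite_measure set X1 -> \bar R})
    (m2 : {sigma_finite_measure set X2 -> \bar R}) (f : X1 -> R) (g : X2 -> R) :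
  measurable_fun setT f -> measurable_fun setT g ->
  (forall x, 0 <= f x) -> (forall y, 0 <= g y) ->
  (\int[product_sigma_finite _ _ _ _ _ m1 m2]_z (f z.1 * g z.2)%:E =
   \int[m1]_x (f x)%:E * \int[m2]_y (g y)%:E)%E.
Proof.
move=> mf mg f0 g0.
rewrite (fubini_tonelli1 (fun z => (f z.1 * g z.2)%:E)).
- rewrite -ge0_integralZr//.
  + apply: eq_integral => x _; rewrite /fubini_F/=.
    under eq_integral do rewrite EFinM.
    rewrite ge0_integralZl_EFin//.
    * by move=> y _; rewrite lee_fin.
    * exact/measurable_EFinP.
  + exact/measurable_EFinP.
  + by move=> x _; rewrite lee_fin.
  + by apply: integral_ge0 => y _; rewrite lee_fin.
- apply/measurable_EFinP; apply: measurable_funM.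
    exact: (measurableT_comp mf measurable_fst).
  exact: (measurableT_comp mg measurable_snd).
- by move=> z; rewrite lee_fin mulr_ge0.
Qed.

Lemma integral_oneDsqrV (R : realType) :
  (\int[@lebesgue_measure R]_x ((1 + x ^+ 2)^-1)%:E = pi%:E)%E.
Proof.
rewrite (@ge0_symfun_integralT _ (fun x : R => (1 + x ^+ 2)^-1)).
- rewrite (_ : [set x | _] = `[0%R, +oo[%classic).
    by rewrite integral0y_oneDsqr -EFinM; congr EFin; field.
  by apply/seteqP; split => x /=; rewrite in_itv/= andbT.
- by move=> x; rewrite invr_ge0 addr_ge0 ?sqr_ge0.
- exact: continuous_oneDsqrV.
- by move=> x /=; rewrite sqrrN.
Qed.

(** A product kernel instead of a radial one, so that the one-dimensional cosine formula can be used
    coordinate by coordinate. *)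
Definition poisson3 {R : realType} (k : R3m R) : R :=
  (1 + k.1.1 ^+ 2)^-1 * (1 + k.1.2 ^+ 2)^-1 * (1 + k.2 ^+ 2)^-1.

Lemma oneDsqr_pos (R : realType) (x : R) : 0 < 1 + x ^+ 2.
Proof. by rewrite ltr_wpDr ?sqr_ge0. Qed.

Lemma poisson3_ge0 (R : realType) (k : R3m R) : 0 <= poisson3 k.
Proof. by rewrite !mulr_ge0 ?invr_ge0 ?(ltW (oneDsqr_pos _ _)). Qed.

Lemma measurable_oneDsqrV (R : realType) :
  measurable_fun setT (fun x : measurableTypeR R => (1 + x ^+ 2)^-1 : R).
Proof. by apply: continuous_measurable_fun; exact: continuous_oneDsqrV. Qed.

Lemma measurable_poisson3 (R : realType) : measurable_fun setT (@poisson3 R).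
Proof.
have mV := measurable_oneDsqrV R.
apply: measurable_funM; last exact: (measurableT_comp mV measurable_snd).
apply: measurable_funM.
  exact: (measurableT_comp mV (measurableT_comp measurable_fst measurable_fst)).
exact: (measurableT_comp mV (measurableT_comp measurable_snd measurable_fst)).
Qed.

Lemma integral_poisson3 (R : realType) :
  (\int[mu3 R]_k (poisson3 k)%:E = (pi ^+ 3)%:E)%E.
Proof.
have mV := measurable_oneDsqrV R.
have V0 (x : R) : 0 <= (1 + x ^+ 2)^-1 by rewrite invr_ge0 ltW// oneDsqr_pos.
rewrite (ge0_integral_product _ _ _ _ _ (mu2 R) (@lebesgue_measure R)
  (fun k : measurableTypeR R * measurableTypeR R =>
    (1 + k.1 ^+ 2)^-1 * (1 + k.2 ^+ 2)^-1 : R)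
  (fun x => (1 + x ^+ 2)^-1))//; last 2 first.
- apply: measurable_funM; first exact: (measurableT_comp mV measurable_fst).
  exact: (measurableT_comp mV measurable_snd).
- by move=> x; rewrite mulr_ge0.
rewrite (ge0_integral_product _ _ _ _ _ (@lebesgue_measure R) (@lebesgue_measure R)
  (fun x => (1 + x ^+ 2)^-1) (fun x => (1 + x ^+ 2)^-1))//.
by rewrite !integral_oneDsqrV -!EFinM !exprS expr0 mulr1 mulrA.
Qed.

Lemma integrable_poisson3 (R : realType) :
  (mu3 R).-integrable setT (EFin \o poisson3).
Proof.
apply/integrableP; split.
  by apply/measurable_EFinP; exact: measurable_poisson3.
under eq_integral do rewrite /= ger0_norm ?poisson3_ge0//.
by rewrite integral_poisson3 ltry.
Qed.

Lemma norm3_sqr (R : realType) (k : R3 R) :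
  norm3 k ^+ 2 = k.1.1 ^+ 2 + k.1.2 ^+ 2 + k.2 ^+ 2.
Proof. by rewrite sqr_sqrtr /dot3 -!expr2// !addr_ge0 ?sqr_ge0. Qed.

Lemma measurable_sqrtr (R : realType) : measurable_fun setT (Num.sqrt : R -> R).
Proof. by apply: continuous_measurable_fun; exact: sqrt_continuous. Qed.

Lemma measurable_sin (R : realType) : measurable_fun setT (sin : R -> R).
Proof. by apply: continuous_measurable_fun; exact: continuous_sin. Qed.

Lemma measurable_coord1 (R : realType) :
  measurable_fun setT (fun k : R3m R => k.1.1 : R).
Proof. exact: measurableT_comp measurable_fst measurable_fst. Qed.

Lemma measurable_coord2 (R : realType) :
  measurable_fun setT (fun k : R3m R => k.1.2 : R).
Proof. exact: measurableT_comp measurable_snd measurable_fst. Qed.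

Lemma measurable_coord3 (R : realType) :
  measurable_fun setT (fun k : R3m R => k.2 : R).
Proof. exact: measurable_snd. Qed.

Lemma measurable_norm3 (R : realType) :
  measurable_fun setT (@norm3 R : R3m R -> R).
Proof.
have m1 := measurable_coord1 R.
have m2 := measurable_coord2 R.
have m3 := measurable_coord3 R.
have md : measurable_fun setT (fun k : R3m R => dot3 k k : R).
  by do 2?apply: measurable_funD; apply: measurable_funM.
exact: (measurableT_comp (measurable_sqrtr R) md).
Qed.

Lemma measurable_symbol (R : realType) (c0 alpha1 gamma : R) :
  0 < c0 -> measurable_fun setT (symbol c0 alpha1 gamma : R3m R -> R).
Proof.
move=> c0_gt0; have mn := measurable_norm3 R.
have mpow p : measurable_fun setT (fun k : R3m R => norm3 k `^ p).
  exact: (measurableT_comp (measurable_powR p) mn).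
have mD : measurable_fun setT (fun k : R3m R =>
    norm3 k ^+ 2 - alpha1 ^+ 2 * (norm3 k `^ (2 * gamma))).
  apply: measurable_funB; first exact: measurable_funX.
  by apply: measurable_funM => //; exact: measurable_cst.
have msqrt (f : R3m R -> R) : measurable_fun setT f ->
    measurable_fun setT (fun k => c0 * Num.sqrt (f k)).
  move=> mf; apply: measurable_funM; first exact: measurable_cst.
  exact: (measurableT_comp (measurable_sqrtr R) mf).
(* On nonnegative reals the inverse is the real power -1, whose measurability is known; [Num.sqrt]
   is nonnegative even where f is negative. *)
have mV (f : R3m R -> R) : measurable_fun setT f ->
    measurable_fun setT (fun k => (c0 * Num.sqrt (f k))^-1).
  move=> mf; under eq_fun do rewrite -powR_inv1 ?mulr_ge0 ?(ltW c0_gt0) ?sqrtr_ge0//.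
  exact: (measurableT_comp (measurable_powR (-1 : R)) (msqrt _ mf)).
have mND : measurable_fun setT (fun k : R3m R =>
    - (norm3 k ^+ 2 - alpha1 ^+ 2 * (norm3 k `^ (2 * gamma)))).
  exact: measurableT_comp mD.
have mexp (f : R3m R -> R) : measurable_fun setT f ->
    measurable_fun setT (fun k => expR (f k)).
  exact: measurableT_comp.
apply: measurable_funM.
  apply: (mexp (fun k => Afun c0 alpha1 gamma k * 1)).
  apply: measurable_funM; last exact: measurable_cst.
  apply: measurableT_comp => //; apply: measurable_funM => //.
apply: measurable_fun_ifT; first by apply: measurable_fun_ltr => //; exact: measurable_cst.
  apply: measurable_funM; last exact: mV.
  apply: (measurableT_comp (measurable_sin R)).
  by apply: measurable_funM; [exact: msqrt|exact: measurable_cst].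
apply: measurable_fun_ifT; last exact: measurable_cst.
  by apply: measurable_fun_ltr => //; exact: measurable_cst.
have mb := msqrt _ mND.
apply: measurable_funM; last exact: mV.
apply: measurable_funM; last exact: measurable_cst.
have mb1 := measurable_funM mb (measurable_cst (1 : R)).
apply: measurable_funB; first exact: mexp mb1.
by apply: mexp; exact: measurableT_comp mb1.
Qed.

(** Both exponentials of [norm_symbol_decay] are O((1 + |k|^2)^-3), and this is dominated by the
    integrable [poisson3] because each 1 + k_i^2 is at most 1 + |k|^2. *)
Lemma integrable_symbol (R : realType) (c0 alpha1 gamma : R) :
  0 < c0 -> 0 < alpha1 -> 0 < gamma < 2 ->
  (mu3 R).-integrable setT (EFin \o symbol c0 alpha1 gamma).
Proof.
move=> c0_gt0 a_gt0 /andP[g_gt0 g_lt2].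
have [C1 C1_gt0 C1P] := expR_powR_decay _ _ _ (mulr_gt0 a_gt0 c0_gt0) g_gt0.
have a2 : 0 < c0 / (2 * alpha1) by rewrite divr_gt0// mulr_gt0.
have g2 : 0 < 2 - gamma by rewrite subr_gt0.
have [C2 C2_gt0 C2P] := expR_powR_decay _ _ _ a2 g2.
have iC : (mu3 R).-integrable setT (EFin \o (fun k => (C1 + C2) * poisson3 k)).
  have := integrableZl measurableT (C1 + C2) (integrable_poisson3 R).
  by apply: eq_integrable => // k _.
apply: le_integrable iC => //.
  by apply/measurable_EFinP; exact: measurable_symbol.
move=> k _ /=; rewrite lee_fin.
rewrite [leRHS]ger0_norm; last first.
  by apply: mulr_ge0; [rewrite addr_ge0 ?ltW|exact: poisson3_ge0].
rewrite (le_trans (norm_symbol_decay _ _ _ c0_gt0 a_gt0 g_gt0 k))//.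
have p_gt0 : 0 < (1 + norm3 k ^+ 2) ^+ 3 by rewrite exprn_gt0// oneDsqr_pos.
have p3 : ((1 + norm3 k ^+ 2) ^+ 3)^-1 <= poisson3 k.
  rewrite /poisson3 -!invfM lef_pV2 ?posrE ?mulr_gt0 ?oneDsqr_pos//.
  rewrite norm3_sqr; pose n := k.1.1 ^+ 2 + k.1.2 ^+ 2 + k.2 ^+ 2.
  rewrite -/n.
  rewrite (_ : (1 + n) ^+ 3 = (1 + n) * (1 + n) * (1 + n)); last by ring.
  rewrite /n {n}.
  have := sqr_ge0 k.1.1; have := sqr_ge0 k.1.2; have := sqr_ge0 k.2 => ? ? ?.
  by rewrite !ler_pM ?mulr_ge0 ?addr_ge0//; lra.
have : (C1 + C2) / (1 + norm3 k ^+ 2) ^+ 3 <= (C1 + C2) * poisson3 k.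
  by rewrite ler_wpM2l// addr_ge0 ?ltW.
apply: le_trans; rewrite ler_pdivlMr// mulrDl lerD//.
  exact: C1P _ (norm3_ge0 _ _).
exact: C2P _ (norm3_ge0 _ _).
Qed.

(** * Cosine transform of the second difference *)

Lemma eq_RintegralT d (X : measurableType d) (R : realType)
    (mu : {measure set X -> \bar R}) (f g : X -> R) :
  f =1 g -> Rintegral mu setT f = Rintegral mu setT g.
Proof. by move=> /funext ->. Qed.
Arguments eq_RintegralT {d X R mu f} g.

Lemma integrable_Mcos d (X : measurableType d) (R : realType)
    (mu : {measure set X -> \bar R}) (g phi : X -> R) :
  mu.-integrable setT (EFin \o g) -> measurable_fun setT phi ->
  mu.-integrable setT (EFin \o (fun p => g p * cos (phi p))).
Proof.
move=> ig mphi.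
have mg : measurable_fun setT g by apply/measurable_EFinP; case/integrableP: ig.
apply: le_integrable ig => //.
  apply/measurable_EFinP/measurable_funM => //.
  exact: (measurableT_comp (measurable_cos R) mphi).
by move=> p _/=; rewrite lee_fin normrM ler_piMr// cos_max.
Qed.

Lemma integrable_divDsqr d (X : measurableType d) (R : realType)
    (mu : {measure set X -> \bar R}) (g phi : X -> R) :
  mu.-integrable setT (EFin \o g) -> measurable_fun setT phi ->
  mu.-integrable setT (EFin \o (fun p => g p / (1 + phi p ^+ 2))).
Proof.
move=> ig mphi.
have mg : measurable_fun setT g by apply/measurable_EFinP; case/integrableP: ig.
apply: le_integrable ig => //.
  apply/measurable_EFinP/measurable_funM => //.
  exact: (measurableT_comp (measurable_oneDsqrV R) mphi).
move=> p _/=; rewrite lee_fin normrM ler_piMr// ger0_norm.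
  by rewrite invf_le1 ?oneDsqr_pos// lerDl sqr_ge0.
by rewrite invr_ge0 ltW// oneDsqr_pos.
Qed.

Lemma measurable_Zcoord (R : realType) (a : R) (h : R3m R -> R) :
  measurable_fun setT h -> measurable_fun setT (fun k => a * h k).
Proof. by move=> mh; apply: measurable_funM => //; exact: measurable_cst. Qed.

Definition scale3 {R : realType} (a : R) (k : R3m R) : R3m R :=
  ((a * k.1.1, a * k.1.2), a * k.2).

(** The product of cosines, not cos(x.k): it matches the product kernel and separates the third
    variable, the one that gets shifted. *)
Definition cos3 {R : realType} (x1 x2 x3 : R) (k : R3m R) : R :=
  cos (x1 * k.1.1) * cos (x2 * k.1.2) * cos (x3 * k.2).

(** [poisson_bound] is applied once per coordinate with phi = N k_i. The frequency x N is at most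
    rho exactly when x <= rho/N, so each application contributes a factor rho/N. *)
Lemma poisson3_bound (R : realType) (g : R3m R -> R) (rho M N : R) :
  (mu3 R).-integrable setT (EFin \o g) -> 0 <= rho -> 0 <= M -> 0 < N ->
  (forall x1 x2 x3, 0 <= x1 -> 0 <= x2 -> 0 <= x3 ->
    `|\int[mu3 R]_k (g k * cos3 x1 x2 x3 k)| <=
      if [&& x1 <= rho, x2 <= rho & x3 <= rho] then M else 0) ->
  `|\int[mu3 R]_k (g k * poisson3 (scale3 N k))| <= (rho / N) ^+ 3 * M.
Proof.
move=> ig rho0 M0 N0 gM.
have m1 := measurable_coord1 R.
have m2 := measurable_coord2 R.
have m3 := measurable_coord3 R.
have r0 : 0 <= rho / N by rewrite divr_ge0// ltW.
have rE x : (x <= rho / N) = (x * N <= rho) by rewrite ler_pdivlMr.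
have xN x : 0 <= x -> 0 <= x * N by move=> ?; rewrite mulr_ge0// ltW.
(* First coordinate integrated against its kernel; the other two still carry cosines. *)
have step1 x2 x3 : 0 <= x2 -> 0 <= x3 ->
    `|\int[mu3 R]_k (g k * cos (x2 * k.1.2) * cos (x3 * k.2) /
       (1 + (N * k.1.1) ^+ 2))| <=
    rho / N * if (x2 <= rho) && (x3 <= rho) then M else 0.
  move=> x20 x30; apply: poisson_bound => //; last 1 first.
  - move=> x x0; rewrite rE.
    rewrite (eq_RintegralT (fun k => g k * cos3 (x * N) x2 x3 k)); last first.
      by move=> k; rewrite /cos3 (mulrA x); ring.
    rewrite (le_trans (gM _ _ _ (xN _ x0) x20 x30))//.
    by case: (x * N <= rho).
  - do 2!(apply: integrable_Mcos; last exact: measurable_Zcoord).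
    exact: ig.
  - exact: measurable_Zcoord.
  - by case: ifP.
have step2 x3 : 0 <= x3 ->
    `|\int[mu3 R]_k (g k / (1 + (N * k.1.1) ^+ 2) * cos (x3 * k.2) /
       (1 + (N * k.1.2) ^+ 2))| <=
    rho / N * (rho / N * if x3 <= rho then M else 0).
  move=> x30; apply: poisson_bound => //; last 1 first.
  - move=> x x0; rewrite rE.
    rewrite (eq_RintegralT (fun k => g k * cos (x * N * k.1.2) *
      cos (x3 * k.2) / (1 + (N * k.1.1) ^+ 2))); last first.
      by move=> k; rewrite (mulrA x); ring.
    rewrite (le_trans (step1 _ _ (xN _ x0) x30))//.
    by case: (x * N <= rho) => //=; rewrite mulr0.
  - apply: integrable_Mcos; last exact: measurable_Zcoord.
    by apply: integrable_divDsqr => //; exact: measurable_Zcoord.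
  - exact: measurable_Zcoord.
  - by rewrite mulr_ge0//; case: ifP.
have -> : (rho / N) ^+ 3 * M = rho / N * (rho / N * (rho / N * M)) by ring.
rewrite (eq_RintegralT (fun k => g k / (1 + (N * k.1.1) ^+ 2) /
  (1 + (N * k.1.2) ^+ 2) / (1 + (N * k.2) ^+ 2))); last first.
  by move=> k; rewrite /poisson3 /scale3/= !mulrA.
apply: poisson_bound => //; last 1 first.
- move=> x x0; rewrite rE.
  rewrite (eq_RintegralT (fun k => g k / (1 + (N * k.1.1) ^+ 2) *
    cos (x * N * k.2) / (1 + (N * k.1.2) ^+ 2))); last first.
    by move=> k; rewrite (mulrA x); ring.
  rewrite (le_trans (step2 _ (xN _ x0)))//.
  by case: (x * N <= rho) => //=; rewrite !mulr0.
- do 2!(apply: integrable_divDsqr; last exact: measurable_Zcoord).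
  exact: ig.
- exact: measurable_Zcoord.
- by apply: mulr_ge0 => //; exact: mulr_ge0.
Qed.

(** Product-to-sum: [cos3] is the mean of cos(x.k) over the four sign choices of x2 and x3, and all
    four frequencies have the same norm. *)
Lemma cos3_vanish (R : realType) (f : R3m R -> R) (rho x1 x2 x3 : R) :
  (mu3 R).-integrable setT (EFin \o f) ->
  (forall x : R3 R, rho <= norm3 x ->
    \int[mu3 R]_k (cos (dot3 x k) * f k) = 0) ->
  rho <= norm3 ((x1, x2), x3) ->
  \int[mu3 R]_k (f k * cos3 x1 x2 x3 k) = 0.
Proof.
move=> intf fx rho_le.
have m1 := measurable_coord1 R.
have m2 := measurable_coord2 R.
have m3 := measurable_coord3 R.
have md (x : R3 R) : measurable_fun setT (fun k : R3m R => dot3 x k).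
  by do 2?apply: measurable_funD; exact: measurable_Zcoord.
have icos (x : R3 R) : (mu3 R).-integrable setT
    (EFin \o (fun k : R3m R => cos (dot3 x k) * f k)).
  have := integrable_Mcos _ _ _ _ _ _ intf (md x).
  by apply: eq_integrable => // k _ /=; rewrite mulrC.
have vanish (s t : R) : s ^+ 2 = 1 -> t ^+ 2 = 1 ->
    \int[mu3 R]_k (cos (dot3 ((x1, s * x2), t * x3) k) * f k) = 0.
  move=> s1 t1; apply: fx; rewrite (le_trans rho_le)//.
  rewrite -ler_sqr ?nnegrE ?norm3_ge0// !norm3_sqr/=.
  by rewrite !exprMn s1 t1 !mul1r.
pose h (s t : R) (k : R3m R) := cos (dot3 ((x1, s * x2), t * x3) k) * f k.
pose H k := h 1 1 k + h 1 (-1) k + (h (-1) 1 k + h (-1) (-1) k).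
rewrite (eq_RintegralT (fun k => 4^-1 * H k)); last first.
  move=> k; rewrite /H /h /cos3 /dot3/= !mulN1r !mul1r !mulNr.
  by rewrite !(cosD, cosN, sinD, sinN); field.
have iD (u v : R3m R -> R) : (mu3 R).-integrable setT (EFin \o u) ->
    (mu3 R).-integrable setT (EFin \o v) ->
    (mu3 R).-integrable setT (EFin \o (fun k => u k + v k)).
  move=> iu iv; have := integrableD measurableT iu iv.
  by apply: eq_integrable.
have iH1 := iD (h 1 1) (h 1 (-1)) (icos _) (icos _).
have iH2 := iD (h (-1) 1) (h (-1) (-1)) (icos _) (icos _).
rewrite RintegralZl//; last exact: (iD _ _ iH1 iH2).
rewrite (RintegralD measurableT iH1 iH2).
rewrite (RintegralD measurableT (icos _) (icos _)).
rewrite (RintegralD measurableT (icos _) (icos _)).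
by rewrite !vanish ?sqrrN ?expr1n// !addr0 mulr0.
Qed.

Definition second_difference {R : realType} (f : R3m R -> R) (eta : R)
    (k : R3m R) : R :=
  f (affine3 1 ((0, 0), eta) k) + f (affine3 1 ((0, 0), - eta) k) - 2 * f k.

Lemma integrable_affine3 (R : realType) (f : R3m R -> R) (a : R) (b : R3m R) :
  0 < a -> (mu3 R).-integrable setT (EFin \o f) ->
  (mu3 R).-integrable setT (EFin \o (fun k => f (affine3 a b k))).
Proof.
move=> a0; apply: scales_measure_integrable (scales_mu3 _ a b a0).
by rewrite !mulr_gt0.
Qed.

Lemma integrable_second_difference (R : realType) (f : R3m R -> R) (eta : R) :
  (mu3 R).-integrable setT (EFin \o f) ->
  (mu3 R).-integrable setT (EFin \o second_difference f eta).
Proof.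
move=> intf.
have i1 b := integrable_affine3 _ _ 1 b ltr01 intf.
have := integrableB measurableT
  (integrableD measurableT (i1 ((0, 0), eta)) (i1 ((0, 0), - eta)))
  (integrableZl measurableT 2 intf).
by apply: eq_integrable.
Qed.

(** Translation moves the shifts from f to the third cosine, and cos(x3 (k3 - eta)) + cos(x3 (k3 +
    eta)) = 2 cos(x3 eta) cos(x3 k3). *)
Lemma second_difference_cos3 (R : realType) (f : R3m R -> R) (eta x1 x2 x3 : R) :
  (mu3 R).-integrable setT (EFin \o f) ->
  \int[mu3 R]_k (second_difference f eta k * cos3 x1 x2 x3 k) =
  2 * (cos (x3 * eta) - 1) * \int[mu3 R]_k (f k * cos3 x1 x2 x3 k).
Proof.
move=> intf.
have m1 := measurable_coord1 R.
have m2 := measurable_coord2 R.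
have m3 := measurable_coord3 R.
pose h (e : R) (k : R3m R) :=
  f k * cos (x1 * k.1.1) * cos (x2 * k.1.2) * cos (x3 * (k.2 - e)).
have ih e : (mu3 R).-integrable setT (EFin \o h e).
  rewrite /h; apply: integrable_Mcos; last first.
    apply: measurable_Zcoord; apply: measurable_funB => //.
  do 2!(apply: integrable_Mcos; last exact: measurable_Zcoord).
  exact: intf.
have shift e : \int[mu3 R]_k (f (affine3 1 ((0, 0), e) k) * cos3 x1 x2 x3 k) =
    \int[mu3 R]_k h e k.
  have s1 : 0 < 1 * 1 * 1 :> R by rewrite !mulr1.
  rewrite [RHS](scales_measure_Rintegral _ _ _ _ _ _ _ s1
    (scales_mu3 _ 1 ((0, 0), e) ltr01) (ih e)).
  rewrite !mul1r; apply: eq_RintegralT => k.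
  by rewrite /h /cos3 /= !addr0 !mul1r addrK !mulrA.
have ishift e : (mu3 R).-integrable setT
    (EFin \o (fun k => f (affine3 1 ((0, 0), e) k) * cos3 x1 x2 x3 k)).
  have := integrable_affine3 _ _ 1 ((0, 0), e) ltr01 (ih e).
  apply: eq_integrable => // k _.
  by rewrite /h /cos3 /= !addr0 !mul1r addrK !mulrA.
have icos : (mu3 R).-integrable setT (EFin \o (fun k => f k * cos3 x1 x2 x3 k)).
  have := ih 0; apply: eq_integrable => // k _.
  by rewrite /h /cos3 /= subr0 !mulrA.
rewrite (eq_RintegralT (fun k =>
  (f (affine3 1 ((0, 0), eta) k) * cos3 x1 x2 x3 k +
   f (affine3 1 ((0, 0), - eta) k) * cos3 x1 x2 x3 k) -
  2 * (f k * cos3 x1 x2 x3 k))); last first.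
  by move=> k; rewrite /second_difference; ring.
rewrite RintegralB//; last 2 first.
- have := integrableD measurableT (ishift eta) (ishift (- eta)).
  by apply: eq_integrable.
- by have := integrableZl measurableT 2 icos; apply: eq_integrable.
rewrite RintegralD// !shift -RintegralD//.
rewrite (eq_RintegralT
  (fun k => 2 * cos (x3 * eta) * (f k * cos3 x1 x2 x3 k))); last first.
  move=> k; rewrite /h /cos3 opprK mulrBr mulrDr cosB cosD; ring.
rewrite !RintegralZl//.
by ring.
Qed.

(** * Behaviour near the origin *)

Lemma norm3_scale3 (R : realType) (a : R) (k : R3m R) : 0 <= a ->
  norm3 (scale3 a k) = a * norm3 k.
Proof.
move=> a0; apply/eqP; rewrite -(@eqrXn2 _ 2)// ?norm3_ge0 ?mulr_ge0 ?norm3_ge0//.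
by rewrite exprMn !norm3_sqr/=; apply/eqP; ring.
Qed.

Lemma norm_coord3_le (R : realType) (k : R3 R) : `|k.2| <= norm3 k.
Proof.
rewrite -ler_sqr ?nnegrE ?norm3_ge0// norm3_sqr real_normK ?num_real//.
by rewrite lerDr addr_ge0 ?sqr_ge0.
Qed.

(** In [second_difference_symbol_near] the upper bound keeps the damping at most 1, so that
    [symbol_le] applies, and the lower bound makes the resulting loss at least of order
    eta^gamma. *)
Lemma norm3_shift_bounds (R : realType) (eta e : R) (k : R3m R) :
  0 < eta -> `|e| = eta -> norm3 k <= eta / 2 ->
  eta / 2 <= norm3 (affine3 1 ((0, 0), e) k) <= 2 * eta.
Proof.
move=> eta0 eE kle; have k3 := le_trans (norm_coord3_le _ k) kle.
apply/andP; split.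
  apply: le_trans (norm_coord3_le _ _); rewrite /= mul1r addrC.
  by have := lerB_normD e k.2; rewrite eE; lra.
have e2 : e ^+ 2 = eta ^+ 2 by rewrite -eE real_normK ?num_real.
have k2e : 2 * k.2 * e <= eta ^+ 2.
  rewrite (le_trans (ler_norm _))// !normrM eE ger0_norm//.
  by rewrite expr2 ler_wpM2r ?(ltW eta0)//; lra.
rewrite -ler_sqr ?nnegrE ?norm3_ge0 ?mulr_ge0 ?(ltW eta0)//.
have n2 : norm3 k ^+ 2 <= eta ^+ 2 / 4.
  have -> : eta ^+ 2 / 4 = (eta / 2) ^+ 2 by rewrite expr_div_n; congr (_ / _); ring.
  by rewrite ler_sqr ?nnegrE ?norm3_ge0 ?divr_ge0 ?(ltW eta0).
rewrite norm3_sqr /= !mul1r !addr0.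
have -> : (k.2 + e) ^+ 2 = k.2 ^+ 2 + 2 * k.2 * e + e ^+ 2 by ring.
rewrite norm3_sqr in n2; rewrite e2 exprMn.
have := sqr_ge0 eta; lra.
Qed.

Section symbol_near_origin.
Context {R : realType} (c0 alpha1 gamma : R).
Hypotheses (c0_gt0 : 0 < c0) (alpha1_gt0 : 0 < alpha1) (gamma_gt0 : 0 < gamma).
Local Notation f := (symbol c0 alpha1 gamma).
Implicit Type k : R3m R.

Lemma symbol_le1 k : f k <= 1.
Proof. by rewrite (le_trans (ler_norm _))// norm_symbol_le1. Qed.

Lemma second_difference_symbol_le eta k :
  second_difference f eta k <= 2 * (1 - f k).
Proof. by rewrite /second_difference mulrBr mulr1 lerB// lerD ?symbol_le1. Qed.

Lemma second_difference_symbol_near eta k : 0 < eta ->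
  alpha1 * c0 * (2 * eta) `^ gamma <= 1 -> norm3 k <= eta / 2 ->
  second_difference f eta k <=
    2 * (1 - f k) - alpha1 * c0 * (eta / 2) `^ gamma.
Proof.
move=> eta0 eta1 kle.
have ac_ge0 : 0 <= alpha1 * c0 by rewrite mulr_ge0 ?ltW.
have shift e : `|e| = eta ->
    f (affine3 1 ((0, 0), e) k) <= 1 - alpha1 * c0 * (eta / 2) `^ gamma / 2.
  move=> eE; have /andP[lo hi] := norm3_shift_bounds _ _ _ _ eta0 eE kle.
  have mono r s : 0 <= r -> r <= s ->
      alpha1 * c0 * r `^ gamma <= alpha1 * c0 * s `^ gamma.
    move=> r0 rs; rewrite ler_wpM2l//.
    by apply: ge0_ler_powR; rewrite ?(ltW gamma_gt0) ?nnegrE// (le_trans r0).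
  have := symbol_le _ _ _ c0_gt0 alpha1_gt0 gamma_gt0 (affine3 1 ((0, 0), e) k).
  have h1 := mono _ _ (norm3_ge0 _ _) hi.
  move=> /(_ (le_trans h1 eta1)) h.
  rewrite (le_trans h)// lerD2l lerN2 ler_pM2r//.
  by apply: mono => //; rewrite divr_ge0// ltW.
have h1 : f (affine3 1 ((0, 0), eta) k) <= 1 - alpha1 * c0 * (eta / 2) `^ gamma / 2.
  by apply: shift; rewrite gtr0_norm.
have h2 : f (affine3 1 ((0, 0), - eta) k) <= 1 - alpha1 * c0 * (eta / 2) `^ gamma / 2.
  by apply: shift; rewrite normrN gtr0_norm.
rewrite /second_difference.
move: (f (affine3 1 _ k)) (f (affine3 1 _ k)) (f k) (alpha1 * c0 * _) h1 h2.
by move=> u v w z h1 h2; lra.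
Qed.

Lemma powR_small (b e : R) : 0 < b -> 0 < e ->
  exists2 d : R, 0 < d & forall r, 0 <= r < d -> r `^ b <= e.
Proof.
move=> b0 e0; exists (e `^ b^-1); first by rewrite powR_gt0.
move=> r /andP[r0 rd].
have -> : e = (e `^ b^-1) `^ b by rewrite -powRrM mulVf ?gt_eqF// powRr1 ?ltW.
by apply: ge0_ler_powR; rewrite ?(ltW b0) ?(ltW rd) ?nnegrE ?powR_ge0.
Qed.

Lemma symbol_continuous_at0 (e : R) : 0 < e ->
  exists2 d : R, 0 < d & forall k, norm3 k < d -> 1 - f k <= e.
Proof.
move=> e0; have ac0 : 0 < alpha1 * c0 by exact: mulr_gt0.
(* The tolerance e is split evenly between the damping x (radius d1) and (c0 |k|)^2/2 (radius
   d2). *)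
have [d1 d10 P1] := powR_small _ (e / 2 / (alpha1 * c0)) gamma_gt0
  (divr_gt0 (divr_gt0 e0 (ltr0Sn _ 1)) ac0).
have c20 : 0 < c0 ^+ 2 by rewrite exprn_gt0.
have [d2 d20 P2] := powR_small _ (e / c0 ^+ 2) (ltr0Sn R 1) (divr_gt0 e0 c20).
exists (Num.min d1 d2); first by rewrite lt_min d10.
move=> k; rewrite lt_min => /andP[k1 k2].
have {}P1 : norm3 k `^ gamma <= e / 2 / (alpha1 * c0) by apply: P1; rewrite norm3_ge0.
have {}P2 : norm3 k ^+ 2 <= e / c0 ^+ 2.
  by rewrite -(powR_mulrn 2 (norm3_ge0 _ k)); apply: P2; rewrite norm3_ge0.
have := symbol_ge _ _ _ c0_gt0 alpha1_gt0 gamma_gt0 k.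
set x := _ * _ * norm3 k `^ gamma.
have x1 : x <= e / 2 by rewrite /x mulrC -ler_pdivlMr.
have s1 : (c0 * norm3 k) ^+ 2 / 2 <= e / 2.
  by rewrite exprMn ler_pM2r// mulrC -ler_pdivlMr.
have s0 : 0 <= (c0 * norm3 k) ^+ 2 / 2 by rewrite divr_ge0 ?sqr_ge0.
have ex1 : expR (- x) <= 1.
  by rewrite -expR0 ler_expR oppr_le0 !mulr_ge0 ?powR_ge0 ?ltW.
have ex2 := expR_ge1Dx (- x).
have ex0 := expR_ge0 (- x).
move: (expR (- x)) ((c0 * norm3 k) ^+ 2 / 2) ex1 ex2 ex0 s0 s1 => E s ex1 ex2 ex0 s0 s1.
by rewrite mulrBr mulr1; nra.
Qed.

End symbol_near_origin.

(** * Rescaling the kernel and passing to the limit *)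

Lemma scale3_affine3 (R : realType) (a : R) (k : R3m R) :
  affine3 a ((0, 0), 0) k = scale3 a k.
Proof. by rewrite /affine3 /scale3 /= !addr0. Qed.

(** Moves the concentration from the kernel to g, so that one dominating function serves for all
    N. *)
Lemma Rintegral_scale3_poisson3 (R : realType) (g : R3m R -> R) (N : R) :
  0 < N -> (mu3 R).-integrable setT (EFin \o (fun k => g k * poisson3 (scale3 N k))) ->
  \int[mu3 R]_k (g (scale3 N^-1 k) * poisson3 k) =
  N ^+ 3 * \int[mu3 R]_k (g k * poisson3 (scale3 N k)).
Proof.
move=> N0 ig; have V0 : 0 < N^-1 by rewrite invr_gt0.
have VVV0 : 0 < N^-1 * N^-1 * N^-1 by rewrite !mulr_gt0.
rewrite (scales_measure_Rintegral _ _ _ _ _ _ _ VVV0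
  (scales_mu3 _ N^-1 ((0, 0), 0) V0) ig).
rewrite mulrA (_ : N ^+ 3 * _ = 1) ?mul1r; last by field; rewrite gt_eqF.
apply: eq_RintegralT => k; rewrite !scale3_affine3; congr (_ * poisson3 _).
by case: k => [[k1 k2] k3]; rewrite /scale3/= !mulrA divff ?mul1r ?gt_eqF.
Qed.

(** A frequency with a coordinate above rho has norm above rho, so the transform vanishes outside
    the cube. Inside, |2 (cos(x3 eta) - 1)| <= (x3 eta)^2 <= (rho eta)^2, and the transform of f is
    at most its L1 norm. *)
Lemma second_difference_poisson3_bound (R : realType) (f : R3m R -> R)
    (rho eta N : R) :
  (mu3 R).-integrable setT (EFin \o f) -> 0 <= rho -> 0 < N ->
  (forall x : R3 R, rho <= norm3 x ->
    \int[mu3 R]_k (cos (dot3 x k) * f k) = 0) ->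
  `|\int[mu3 R]_k (second_difference f eta k * poisson3 (scale3 N k))| <=
  (rho / N) ^+ 3 * ((rho * eta) ^+ 2 * \int[mu3 R]_k `|f k|).
Proof.
move=> intf rho0 N0 fx.
have M0 : 0 <= \int[mu3 R]_k `|f k| by apply: Rintegral_ge0.
apply: poisson3_bound => //.
- exact: integrable_second_difference.
- by rewrite mulr_ge0 ?sqr_ge0.
move=> x1 x2 x3 x10 x20 x30; rewrite second_difference_cos3//.
have coord_le (y : R3 R) (z : R) : 0 <= z -> z ^+ 2 <= norm3 y ^+ 2 -> z <= norm3 y.
  by move=> z0; rewrite ler_sqr ?nnegrE ?norm3_ge0.
have zero : rho <= norm3 ((x1, x2), x3) ->
    `|2 * (cos (x3 * eta) - 1) * \int[mu3 R]_k (f k * cos3 x1 x2 x3 k)| <= 0.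
  by move=> h; rewrite (cos3_vanish _ _ _ _ _ _ intf fx h) mulr0 normr0.
have S1 := sqr_ge0 x1; have S2 := sqr_ge0 x2; have S3 := sqr_ge0 x3.
case: ifPn => [/and3P[_ _ x3r]|]; last first.
  rewrite !negb_and -!ltNge => /or3P[] /ltW h; apply: zero; apply: (le_trans h);
    apply: coord_le => //; rewrite norm3_sqr/=; lra.
rewrite normrM ler_pM//.
  rewrite ler0_norm; last by have := cos_le1 (x3 * eta); lra.
  have := cos_ge_quadratic _ (x3 * eta).
  have : (x3 * eta) ^+ 2 <= (rho * eta) ^+ 2.
    by rewrite !exprMn ler_wpM2r ?sqr_ge0// ler_sqr ?nnegrE.
  lra.
have ic : (mu3 R).-integrable setT (EFin \o (fun k => f k * cos3 x1 x2 x3 k)).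
  have h := integrable_Mcos _ _ _ _ _ _
    (integrable_Mcos _ _ _ _ _ _
      (integrable_Mcos _ _ _ _ _ _ intf
        (measurable_Zcoord _ x1 _ (measurable_coord1 R)))
      (measurable_Zcoord _ x2 _ (measurable_coord2 R)))
    (measurable_Zcoord _ x3 _ (measurable_coord3 R)).
  by move: h; apply: eq_integrable => // k _; rewrite /cos3 /= !mulrA.
rewrite (le_trans (le_normr_Rintegral measurableT ic))//.
apply: le_Rintegral => //.
- exact: integrable_norm ic.
- exact: integrable_norm intf.
- move=> k _; rewrite normrM ler_piMr// /cos3 !normrM.
  by rewrite !mulr_ile1 ?mulr_ge0 ?cos_max.
Qed.

Lemma measurable_scale3 (R : realType) (a : R) :
  measurable_fun setT (@scale3 R a : R3m R -> R3m R).
Proof.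
apply/measurable_fun_pairP; split; last first.
  exact: (measurable_Zcoord _ a _ (measurable_coord3 R)).
apply/measurable_fun_pairP; split.
  exact: (measurable_Zcoord _ a _ (measurable_coord1 R)).
exact: (measurable_Zcoord _ a _ (measurable_coord2 R)).
Qed.

(** The rescaled integrals of the second difference are at least -Q for every N, while a majorant of
    them tends to -kap pi^3, with pi^3 the mass of [poisson3]. *)
Lemma symbol_flatness (R : realType) (c0 alpha1 gamma rho eta : R) :
  0 < c0 -> 0 < alpha1 -> 0 < gamma < 2 -> 0 <= rho -> 0 < eta ->
  (forall x : R3 R, rho <= norm3 x ->
    \int[mu3 R]_k (cos (dot3 x k) * symbol c0 alpha1 gamma k) = 0) ->
  alpha1 * c0 * (2 * eta) `^ gamma <= 1 ->
  alpha1 * c0 * (eta / 2) `^ gamma * pi ^+ 3 <=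
  rho ^+ 3 * ((rho * eta) ^+ 2 *
    \int[mu3 R]_k `|symbol c0 alpha1 gamma k|).
Proof.
move=> c0_gt0 a_gt0 g02 rho0 eta0 fx eta1; have /andP[g_gt0 _] := g02.
have intf := integrable_symbol _ _ _ _ c0_gt0 a_gt0 g02.
set f := symbol c0 alpha1 gamma; rewrite -/f in intf fx *.
set Q := rho ^+ 3 * _; move kapE : (alpha1 * c0 * (eta / 2) `^ gamma) => kap.
have kap0 : 0 <= kap by rewrite -kapE !mulr_ge0 ?powR_ge0 ?(ltW c0_gt0) ?(ltW a_gt0).
have f1 k : f k <= 1 by exact: symbol_le1.
have fN1 k : -1 <= f k.
  by have := norm_symbol_le1 _ _ _ c0_gt0 a_gt0 g_gt0 k; rewrite ler_norml => /andP[].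
have mf : measurable_fun setT (f : R3m R -> R) by exact: measurable_symbol.
pose S (n : nat) (k : R3m R) := scale3 (n.+1%:R : R)^-1 k.
have V0 n : 0 < (n.+1%:R : R)^-1 by rewrite invr_gt0.
(* A majorant of the rescaled second difference that evaluates f only at [S n k], which tends to 0;
   only continuity at the origin enters the limit. *)
pose v (n : nat) (k : R3m R) : R :=
  2 * (1 - f (S n k)) - (if norm3 (S n k) <= eta / 2 then kap else 0).
have dv n k : second_difference f eta (S n k) <= v n k.
  rewrite /v; case: ifPn => h; last first.
    by rewrite subr0; exact: second_difference_symbol_le.
  by rewrite -kapE; exact: second_difference_symbol_near.
have mfS n : measurable_fun setT (fun k => f (S n k)).
  exact: (measurableT_comp mf (measurable_scale3 _ _)).
have mv n : measurable_fun setT (v n).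
  apply: measurable_funB.
    exact: (measurable_Zcoord _ 2 _ (measurable_funB (measurable_cst (1 : R)) (mfS n))).
  apply: measurable_fun_ifT; [|exact: measurable_cst|exact: measurable_cst].
  apply: measurable_fun_ler; last exact: measurable_cst.
  exact: (measurableT_comp (measurable_norm3 R) (measurable_scale3 _ _)).
(* Since |f| <= 1, the term 2 (1 - f) lies between 0 and 4. *)
have vb n k : `|v n k| <= 4 + kap.
  have := f1 (S n k); have := fN1 (S n k); rewrite /v ler_norml.
  move: (f (S n k)) => u.
  by case: ifP => _ a b; apply/andP; split; lra.
have iP := integrable_poisson3 R.
have mP := measurable_poisson3 R.
have idom : (mu3 R).-integrable setT (EFin \o (fun k => (4 + kap) * poisson3 k)).
  by have := integrableZl measurableT (4 + kap) iP; apply: eq_integrable.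
have vdom n k : `|v n k * poisson3 k| <= (4 + kap) * poisson3 k.
  by rewrite normrM (ger0_norm (poisson3_ge0 _ k)) ler_wpM2r ?poisson3_ge0.
have ivP n : (mu3 R).-integrable setT (EFin \o (fun k => v n k * poisson3 k)).
  apply: le_integrable idom => //.
    by apply/measurable_EFinP; exact: measurable_funM.
  by move=> k _ /=; rewrite lee_fin (le_trans (vdom n k))// ler_norm.
(* The Jacobian N^3, with N = n + 1, cancels the N^-3 of the kernel bound. *)
have lower n : - Q <= \int[mu3 R]_k (v n k * poisson3 k).
  have N0 : 0 < n.+1%:R :> R by [].
  have isd := integrable_second_difference _ _ eta intf.
  have isdP : (mu3 R).-integrable setT
      (EFin \o (fun k => second_difference f eta k * poisson3 (scale3 n.+1%:R k))).
    have h := integrable_divDsqr _ _ _ _ _ _ (integrable_divDsqr _ _ _ _ _ _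
      (integrable_divDsqr _ _ _ _ _ _ isd
        (measurable_Zcoord _ n.+1%:R _ (measurable_coord1 R)))
      (measurable_Zcoord _ n.+1%:R _ (measurable_coord2 R)))
      (measurable_Zcoord _ n.+1%:R _ (measurable_coord3 R)).
    by move: h; apply: eq_integrable => // k _; rewrite /poisson3/= !mulrA.
  have E := Rintegral_scale3_poisson3 _ _ _ N0 isdP.
  have B := second_difference_poisson3_bound _ _ _ eta _ intf rho0 N0 fx.
  apply: (@le_trans _ _ (\int[mu3 R]_k
      (second_difference f eta (S n k) * poisson3 k))).
    move: B; rewrite ler_norml => /andP[Bl _].
    rewrite E (le_trans _ (ler_wpM2l (exprn_ge0 3 (ltW N0)) Bl))//.
    move: (n.+1%:R : R) N0 => N N0.
    rewrite mulrN lerN2 le_eqVlt; apply/orP; left; apply/eqP.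
    by rewrite /Q; field; rewrite gt_eqF.
  apply: le_Rintegral => //.
    have := integrable_affine3 _ _ _ ((0, 0), 0) (V0 n) isdP.
    apply: eq_integrable => // k _ /=; rewrite !scale3_affine3.
    congr (_ * poisson3 _)%:E.
    by case: k => [[k1 k2] k3]; rewrite /scale3/= !mulrA divff ?mul1r ?gt_eqF.
  by move=> k _; rewrite ler_wpM2r ?poisson3_ge0.
have cv k : v n k * poisson3 k @[n --> \oo] --> - kap * poisson3 k.
  apply: cvgM; last exact: cvg_cst.
  have Sk : norm3 (S n k) @[n --> \oo] --> (0 : R).
    rewrite (_ : (fun n => _) = (fun n => (n.+1%:R : R)^-1 * norm3 k)); last first.
      by apply/funext => n; rewrite norm3_scale3// ltW.
    rewrite -(mul0r (norm3 k)); apply: cvgM; last exact: cvg_cst.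
    exact: cvg_harmonic.
  apply/cvgrPdist_le => e e0.
  have [d d0 dP] := symbol_continuous_at0 _ _ _ c0_gt0 a_gt0 g_gt0 (e / 2)
    (divr_gt0 e0 (ltr0Sn _ 1)).
  near=> n.
  have Snd : norm3 (S n k) < d.
    near: n; exact: (cvgr_lt _ Sk).
  have Sne : norm3 (S n k) <= eta / 2.
    near: n; apply: (cvgr_le _ Sk); exact: divr_gt0.
  (* Eventually the indicator is on, and v n k + kap = 2 (1 - f) is at most twice e/2. *)
  rewrite /v Sne ler_norml; have := dP _ Snd; have := f1 (S n k); rewrite -/f.
  move: (f (S n k)) => u.
  by move=> a b; apply/andP; split; lra.
have cvI : (\int[mu3 R]_k (v n k * poisson3 k)%:E)%E @[n --> \oo] -->
    (\int[mu3 R]_k (- kap * poisson3 k)%:E)%E.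
  apply: (@dominated_cvg _ _ _ (mu3 R) setT measurableT
    (fun n k => (v n k * poisson3 k)%:E) (fun k => (- kap * poisson3 k)%:E)
    (fun k => ((4 + kap) * poisson3 k)%:E)) => //.
  - by move=> n; case/integrableP: (ivP n).
  - by move=> k _; apply/fine_cvgP; split => //; [apply: nearW|exact: cv].
  - by move=> n k _; rewrite /= lee_fin; exact: vdom.
have iK : (\int[mu3 R]_k (- kap * poisson3 k)%:E = (- kap * pi ^+ 3)%:E)%E.
  under eq_integral do rewrite EFinM.
  by rewrite integralZl// integral_poisson3 -EFinM.
rewrite iK in cvI.
have : ((- Q)%:E <= (- kap * pi ^+ 3)%:E)%E.
  apply: (cvge_to_ge cvI); apply: nearW => n.
  have := lower n; rewrite -lee_fin /Rintegral fineK//.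
  exact: integrable_fin_num (ivP n).
by rewrite lee_fin mulNr lerN2.
Unshelve. all: by end_near. Qed.

(** * The contradiction for small eta *)

Theorem theorem8 (R : realType) (c0 alpha1 gamma : R) :
  0 < c0 -> 0 < alpha1 < 1 -> 0 < gamma < 2 ->
  ~ (exists c : R, 0 < c /\
       forall t : R, 0 < t ->
         support3 (fun x : R3 R => Gfun c0 alpha1 gamma x t) `<=` ball3 (c * t)).
Proof.
move=> c0_gt0 /andP[a_gt0 _] g02 [c [c_gt0 supp]]; have /andP[g_gt0 g_lt2] := g02.
(* At t = 1 the support lies in the open ball of radius c; the real part of [F3D] is the cosine
   transform, and its prefactor is nonzero. *)
have fx (x : R3 R) : c <= norm3 x ->
    \int[mu3 R]_k (cos (dot3 x k) * symbol c0 alpha1 gamma k) = 0.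
  move=> cx; have s0 : (2 * pi : R) `^ (3%:R / 2) != 0.
    by rewrite gt_eqF// powR_gt0// mulr_gt0// pi_gt0.
  have G0 : Gfun c0 alpha1 gamma x 1 = 0.
    apply/eqP/negPn/negP => Gx.
    have Sx : support3 (fun y : R3 R => Gfun c0 alpha1 gamma y 1) x.
      by apply: subset_closure; exact: Gx.
    by have := supp 1 ltr01 x Sx; rewrite /ball3 /= mulr1 ltNge cx.
  move: G0 => /eqP; rewrite /Gfun mulf_eq0 => /orP[/eqP[/eqP]|].
    rewrite /Heaviside ler01 mul1r mulf_eq0 invr_eq0 (negbTE s0) orbF.
    by rewrite expf_eq0/= gt_eqF.
  rewrite F3DE => /eqP[/eqP + _].
  by rewrite mulf_eq0 invr_eq0 (negbTE s0) orbF => /eqP.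
set M := \int[mu3 R]_k `|symbol c0 alpha1 gamma k|.
have M0 : 0 <= M by apply: Rintegral_ge0.
pose A := alpha1 * c0 * 2^-1 `^ gamma * pi ^+ 3.
have A_gt0 : 0 < A by rewrite /A !mulr_gt0 ?powR_gt0 ?exprn_gt0 ?pi_gt0.
(* The added 1 makes Q positive, so that A/Q can be formed. *)
pose Q := c ^+ 5 * M + 1.
have Q_gt0 : 0 < Q by rewrite ltr_wpDl// mulr_ge0// exprn_ge0// ltW.
have g2 : 0 < 2 - gamma by rewrite subr_gt0.
have [d1 d10 P1] := powR_small _ _ g_gt0
  (divr_gt0 (@ltr01 R) (mulr_gt0 a_gt0 c0_gt0)).
have [d2 d20 P2] := powR_small _ _ g2
  (divr_gt0 (divr_gt0 A_gt0 Q_gt0) (ltr0Sn R 1)).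
(* The first bound gives 2 eta < d1, hence damping at most 1; the second gives eta < d2, hence
   eta^(2 - gamma) <= A/(2Q). *)
pose eta := Num.min (d1 / 4) (d2 / 2).
have eta0 : 0 < eta by rewrite lt_min !divr_gt0.
have etad1 : 2 * eta < d1.
  have : eta <= d1 / 4 by rewrite ge_min lexx.
  lra.
have etad2 : eta < d2.
  have : eta <= d2 / 2 by rewrite ge_min lexx orbT.
  lra.
have h1 : alpha1 * c0 * (2 * eta) `^ gamma <= 1.
  rewrite mulrC -ler_pdivlMr ?mulr_gt0//; apply: P1.
  by rewrite etad1 mulr_ge0// ltW.
have h2 : eta `^ (2 - gamma) <= A / Q / 2 by apply: P2; rewrite etad2 ltW.
have := symbol_flatness _ _ _ _ _ _ c0_gt0 a_gt0 g02 (ltW c_gt0) eta0 fx h1.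
rewrite -/M powRM ?(ltW eta0)//.
have -> : alpha1 * c0 * (eta `^ gamma * 2^-1 `^ gamma) * pi ^+ 3 = A * eta `^ gamma.
  by rewrite /A; ring.
have eg : 0 < eta `^ gamma by rewrite powR_gt0.
(* Split eta^2 as eta^(2 - gamma) eta^gamma and cancel eta^gamma: what remains is A <= c^5 M eta^(2
   - gamma) <= A/2. *)
have -> : c ^+ 3 * ((c * eta) ^+ 2 * M) =
    c ^+ 5 * M * (eta `^ (2 - gamma) * eta `^ gamma).
  rewrite -powRD; last by rewrite (gt_eqF eta0) implybT.
  by rewrite subrK powR_mulrn ?(ltW eta0)//; ring.
rewrite mulrA ler_pM2r// => h3.
have : A <= Q * (A / Q / 2).
  rewrite (le_trans h3)// ler_pM ?mulr_ge0 ?powR_ge0 ?exprn_ge0 ?(ltW c_gt0)//.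
  by rewrite /Q lerDl.
rewrite (_ : Q * _ = A / 2); last by field; rewrite gt_eqF.
by lra.
Qed.
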